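(* Let $(A,B,C,D)$ be reduced words in $a^{\pm1},b^{\pm1}$. Then $(A,B,C,D)$ defines a local $\mathrm{Aut}(F_3)$ braid representation if and only if, up to natural symmetries, $(A,B,C,D)$ is one of the following: ($T$) $(a,b,a,b)$; ($T'$) $(a,b^{-1},a^{-1},b)$; ($A_r$-1) $(a^{r}ba^{-r},\,a,\,a^{r}ba^{-r},\,a)$, $r\in\mathbb{Z}_{\ge0}$; ($A_r$-2) $(a^{r}ba^{-r},\,a,\,a^{r}b^{-1}a^{-r},\,a^{-1})$, $r\in\mathbb{Z}_{\ge0}$; ($A_r$-3) $(a^{r}b^{-1}a^{-r},\,a^{-1},\,a^{-r}b^{-1}a^{r},\,a^{-1})$, $r\in\mathbb{Z}_{\ge0}$; ($B$-1) $(b^{-1},a,b^{-1},a)$; ($B$-2) $(b^{-1},a,b,a^{-1})$; ($C$-1) $(ab^{-1}a,\,a,\,ab^{-1}a,\,a)$; ($C$-2) $(ab^{-1}a,\,a,\,aba,\,a^{-1})$; ($C$-3) $(aba,\,a^{-1},\,aba,\,a^{-1})$; ($D$-1) $(a^{-1}b^{-1}a,\,b^{2}a,\,a^{-1}b^{-1}a,\,b^{2}a)$; ($D$-2) $(aba^{-1},\,b^{2}a^{-1},\,a^{-1}b^{-1}a,\,b^{2}a)$; ($D$-3) $(a^{-1}b^{-1}a,\,b^{2}a,\,a^{-1}ba,\,a^{-1}b^{2})$; ($D$-4) $(aba^{-1},\,b^{2}a^{-1},\,a^{-1}ba,\,a^{-1}b^{2})$.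
   Context: $F_2$ is the free group on $a,b$; $F_3$ is the free group on $x_1,x_2,x_3$; $B_3$ is the 3-strand braid group with standard generators $\sigma_1,\sigma_2$ (acting on the right). For a word $W$ in $a^{\pm1},b^{\pm1}$ and elements $U,V$ of a group, $W(U,V)$ denotes the result of substituting $U$ for $a$ and $V$ for $b$. A quadruple $(A,B,C,D)$ of reduced words in $a^{\pm1},b^{\pm1}$ defines a local $\mathrm{Aut}(F_3)$ braid representation if the endomorphisms $\tau:a\mapsto A,\ b\mapsto B$ and $\kappa: a\mapsto C,\ b\mapsto D$ of $F_2$ are automorphisms and the automorphisms $s_1,s_2$ of $F_3$ given by $s_1: x_1\mapsto A(x_1,x_2),\ x_2\mapsto B(x_1,x_2),\ x_3\mapsto x_3$ and $s_2: x_1\mapsto x_1,\ x_2\mapsto C(x_2,x_3),\ x_3\mapsto D(x_2,x_3)$ satisfy $s_1s_2s_1=s_2s_1s_2$, so that $\sigma_1\mapsto s_1$, $\sigma_2\mapsto s_2$ defines an action of $B_3$ on $F_3$. Natural symmetries act on such quadruples as follows. Inverse: replace $(A,B,C,D)$ by the reduced words representing $\tau^{-1}(a),\tau^{-1}(b),\kappa^{-1}(a),\kappa^{-1}(b)$. Swap: replace $(A,B,C,D)$ by $(D^{\sigma},C^{\sigma},B^{\sigma},A^{\sigma})$, where $W^{\sigma}$ is obtained from $W$ by interchanging the letters $a$ and $b$ (e.g. $(a^{-2}ba)^{\sigma}=b^{-2}ab$). Backward: replace $(A,B,C,D)$ by $(\overleftarrow{A},\overleftarrow{B},\overleftarrow{C},\overleftarrow{D})$,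 where $\overleftarrow{W}$ is $W$ read backwards (e.g. $\overleftarrow{b^{-1}aba^{2}}=a^{2}bab^{-1}$). ''Up to natural symmetries'' means: obtained from a listed quadruple by a composition of these operations. *)

(* Defs.v *)
From mathcomp Require Import all_boot.
From Stdlib Require Import Relation_Operators.
Set Implicit Arguments. Unset Strict Implicit. Unset Printing Implicit Defensive.

(* A letter of the free group on generators 'I_n: (generator, is_inverse). *)
Definition letter (n : nat) := ('I_n * bool)%type.
Definition word (n : nat) := seq (letter n).

Definition cancels n (x y : letter n) : bool := (x.1 == y.1) && (x.2 != y.2).

Definition reduced n (w : word n) : bool :=
  if w is x :: t then path (fun u v => ~~ cancels u v) x t else true.

Definition reduce n (w : word n) : word n :=
  foldr (fun l acc => match acc with
                      | x :: t => if cancels l x then t else l :: acc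
                      | [::] => [:: l] end) [::] w.

Definition winv n (w : word n) : word n := rev (map (fun l => (l.1, ~~ l.2)) w).

Definition subst n m (f : 'I_n -> word m) (w : word n) : word m :=
  reduce (flatten (map (fun l => if l.2 then winv (f l.1) else f l.1) w)).

Definition is_aut n (f : 'I_n -> word n) : Prop :=
  (forall u v, reduced u -> reduced v -> subst f u = subst f v -> u = v) /\
  (forall v, reduced v -> exists u, reduced u /\ subst f u = v).

Definition ga : 'I_2 := ord0.
Definition gb : 'I_2 := ord_max.
Definition x1 : 'I_3 := ord0.
Definition x2 : 'I_3 := @Ordinal 3 1 isT.
Definition x3 : 'I_3 := ord_max.

Definition relabel n m (e : 'I_n -> 'I_m) (w : word n) : word m :=
  map (fun l => (e l.1, l.2)) w.

Definition quad := (word 2 * word 2 * word 2 * word 2)%type.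

Definition fun2 (U V : word 2) : 'I_2 -> word 2 := fun i => if i == ga then U else V.

Definition e12 (i : 'I_2) : 'I_3 := if i == ga then x1 else x2.
Definition e23 (i : 'I_2) : 'I_3 := if i == ga then x2 else x3.

Definition s1f (q : quad) : 'I_3 -> word 3 :=
  let: (A, B, C, D) := q in
  fun i => if i == x1 then relabel e12 A else if i == x2 then relabel e12 B
           else [:: (i, false)].
Definition s2f (q : quad) : 'I_3 -> word 3 :=
  let: (A, B, C, D) := q in
  fun i => if i == x2 then relabel e23 C else if i == x3 then relabel e23 D
           else [:: (i, false)].

Definition local_braid_rep (q : quad) : Prop :=
  let: (A, B, C, D) := q in
  is_aut (fun2 A B) /\ is_aut (fun2 C D) /\
  forall i : 'I_3,
    subst (s1f q) (subst (s2f q) (s1f q i)) = subst (s2f q) (subst (s1f q) (s2f q i)).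

Definition la : letter 2 := (ga, false).
Definition lA : letter 2 := (ga, true).
Definition lb : letter 2 := (gb, false).
Definition lB : letter 2 := (gb, true).

Definition swapw (w : word 2) : word 2 :=
  map (fun l => (if l.1 == ga then gb else ga, l.2)) w.

Definition sym_swap (q : quad) : quad :=
  let: (A, B, C, D) := q in (swapw D, swapw C, swapw B, swapw A).
Definition sym_back (q : quad) : quad :=
  let: (A, B, C, D) := q in (rev A, rev B, rev C, rev D).
Definition sym_inv (q q' : quad) : Prop :=
  let: (A, B, C, D) := q in let: (A', B', C', D') := q' in
  is_aut (fun2 A B) /\ is_aut (fun2 C D) /\
  [/\ reduced A', reduced B', reduced C' & reduced D'] /\
  subst (fun2 A B) A' = [:: la] /\ subst (fun2 A B) B' = [:: lb] /\
  subst (fun2 C D) C' = [:: la] /\ subst (fun2 C D) D' = [:: lb].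

Definition sym_step (q q' : quad) : Prop :=
  q' = sym_swap q \/ q' = sym_back q \/ sym_inv q q'.

Definition up_to_sym (q q' : quad) : Prop := clos_refl_trans quad sym_step q q'.

Definition apow (r : nat) : word 2 := nseq r la.
Definition apowi (r : nat) : word 2 := nseq r lA.

Definition listed (q : quad) : Prop :=
     q = ([:: la], [:: lb], [:: la], [:: lb])
  \/ q = ([:: la], [:: lB], [:: lA], [:: lb])
  \/ (exists r : nat, q = (apow r ++ lb :: apowi r, [:: la],
                           apow r ++ lb :: apowi r, [:: la]))
  \/ (exists r : nat, q = (apow r ++ lb :: apowi r, [:: la],
                           apow r ++ lB :: apowi r, [:: lA]))
  \/ (exists r : nat, q = (apow r ++ lB :: apowi r, [:: lA],
                           apowi r ++ lB :: apow r, [:: lA]))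
  \/ q = ([:: lB], [:: la], [:: lB], [:: la])
  \/ q = ([:: lB], [:: la], [:: lb], [:: lA])
  \/ q = ([:: la; lB; la], [:: la], [:: la; lB; la], [:: la])
  \/ q = ([:: la; lB; la], [:: la], [:: la; lb; la], [:: lA])
  \/ q = ([:: la; lb; la], [:: lA], [:: la; lb; la], [:: lA])
  \/ q = ([:: lA; lB; la], [:: lb; lb; la], [:: lA; lB; la], [:: lb; lb; la])
  \/ q = ([:: la; lb; lA], [:: lb; lb; lA], [:: lA; lB; la], [:: lb; lb; la])
  \/ q = ([:: lA; lB; la], [:: lb; lb; la], [:: lA; lb; la], [:: lA; lb; lb])
  \/ q = ([:: la; lb; lA], [:: lb; lb; lA], [:: lA; lb; la], [:: lA; lb; lb]).

(* Main.v *)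
(* Write s1 = tau * id on F3 = <x1, x2> * <x3> and s2 = id * kappa on F3 = <x1> * <x2, x3>. The braid
   relation says that s1 fixes A(x1, C(x2, x3)), that s2 fixes D(B(x1, x2), x3), and one further equation
   for x2. On homology it leaves five possibilities for the matrices of tau and kappa.

   - Both matrices diagonal: killing x3 turns the braid relation into one between tau and the diagonal
     involution eps, so that sigma = tau eps satisfies sigma^4 = sigma and acts trivially on homology. The
     first Magnus coefficient moved by sigma would change additively under iteration, hence sigma = id.
   - Otherwise, s1 acts on the normal form in <x1, x2> * <x3> syllable by syllable, so every syllable of
     A(x1, C(x2, x3)) is fixed by tau and its homology class lies in a known line. A homomorphism
     <x1, x2> -> Z that vanishes on this line gives an identity A(a^m1, C(a^m2, b)) = b^n in F2, and
     ping-pong then forces C = a^p b^m a^r and determines A. The symmetry "swap" treats B and D. The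
     remaining exponents are pinned down by a few Magnus coefficients.
   - The fifth possibility, with traces zero, is refuted by evaluating the equations in the alternating
     group A4. *)

Require Import Defs.
From mathcomp Require Import all_boot.
From Stdlib Require Import Relation_Operators.
From HB Require Import structures.
From mathcomp Require Import all_algebra all_fingroup.
From mathcomp Require Import zify ring.
Set Implicit Arguments. Unset Strict Implicit. Unset Printing Implicit Defensive.
Import GRing.Theory Num.Theory.
Local Open Scope group_scope.

(** * Free groups as groups of reduced words *)

Section Words.
Variable n : nat.
Implicit Types (l x y : letter n) (u v w : word n).

(** By freeness of F3 the braid relation holds for all triples (x, y, z) in all groups, and each
    case evaluates it at a convenient triple: z = 1, elements of F2, elements of A4. The obstacle is
    that A and C are unknown words nested in each other, so neither can be solved for directly.
    Sending x1 and x2 to powers a^m1, a^m2 of one letter makes the fixed pieces disappear; what is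
    left says that b^n lies in the subgroup generated by a and V = C(a^m2, b), which is a statement
    about V alone. The pair (m1, m2) has to vanish on the vectors fixed by the matrix of tau. In the
    parabolic class (traces 2) the second-order coefficients of the braid relation still allow a
    one-parameter family of exponents; that A and B form a basis of F2 leaves three members, which
    give the types C and D. The group A4 suits the trace-zero class because the off-diagonal entries
    there are 1 and 3 up to sign, and cubes vanish outside the Klein four-group. *)

Definition linv l : letter n := (l.1, ~~ l.2).

Lemma linvK : involutive linv.
Proof. by case=> i s; rewrite /linv /= negbK. Qed.

Lemma cancelsE x y : cancels x y = (y == linv x).
Proof. by case: x y => [i s] [j t]; rewrite /cancels /linv /= xpair_eqE eq_sym; case: s t => [] []. Qed.

Lemma cancels_sym x y : cancels x y = cancels y x.
Proof. by rewrite !cancelsE -(inv_eq linvK) eq_sym. Qed.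

Lemma cancels_linv x y : cancels (linv x) (linv y) = cancels x y.
Proof. by rewrite !cancelsE (inj_eq (inv_inj linvK)). Qed.

Lemma reducedE w : reduced w = sorted (fun x y => ~~ cancels x y) w.
Proof. by case: w. Qed.

Lemma reduced_cons x w : reduced (x :: w) -> reduced w.
Proof. by case: w => //= y w /andP[]. Qed.

(** The step function of [reduce], named so that [reduce] is a fold of [push] by conversion; on
    reduced words it is left multiplication by a letter. *)
Definition push l w : word n :=
  if w is x :: t then if cancels l x then t else l :: w else [:: l].

Lemma reduceE w : reduce w = foldr push [::] w.
Proof. by []. Qed.

Lemma reduced_push l w : reduced w -> reduced (push l w).
Proof.
case: w => //= x w red_xw; case: ifP => [_|/negbT]; last by move=> /= ->.
exact: reduced_cons red_xw.
Qed.

Lemma reduced_foldr_push u w : reduced w -> reduced (foldr push w u).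
Proof. by move=> red_w; elim: u => //= l u; apply: reduced_push. Qed.

Lemma reduced_reduce w : reduced (reduce w).
Proof. exact: reduced_foldr_push. Qed.

Lemma push_id l w : reduced (l :: w) -> push l w = l :: w.
Proof. by case: w => //= x w /andP[/negPf->]. Qed.

Lemma reduce_id w : reduced w -> reduce w = w.
Proof.
elim: w => //= l w IHw red_lw.
by have:= red_lw; rewrite -/(reduce w) IHw ?(reduced_cons red_lw) // => /push_id.
Qed.

(** Van der Waerden's trick: letters act on reduced words by permutations, so associativity needs no
    confluence argument. *)
Lemma push_linvK l w : reduced w -> push l (push (linv l) w) = w.
Proof.
case: w => [|x w] red_w /=; first by rewrite cancelsE eqxx.
rewrite cancelsE linvK; case: eqP => [<-|_] /=; last by rewrite cancelsE eqxx.
exact: push_id.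
Qed.

Lemma foldr_push_reduce u w : reduced w -> foldr push w (reduce u) = foldr push w u.
Proof.
move=> red_w; elim: u => //= l u <-; rewrite -/(reduce u).
case: (reduce u) => [|x t] //=; rewrite cancelsE; case: eqP => [->|] //=.
by rewrite push_linvK // reduced_foldr_push.
Qed.

Lemma reduce_cat u v : reduce (u ++ v) = reduce (reduce u ++ reduce v).
Proof.
rewrite !reduceE !foldr_cat -!reduceE (reduce_id (reduced_reduce v)).
by rewrite foldr_push_reduce ?reduced_reduce.
Qed.

Lemma winvE w : winv w = rev (map linv w).
Proof. by []. Qed.

Lemma winv_cons l w : winv (l :: w) = rcons (winv w) (linv l).
Proof. by rewrite /winv /= rev_cons. Qed.

Lemma winv_cat u v : winv (u ++ v) = winv v ++ winv u.
Proof. by rewrite /winv map_cat rev_cat. Qed.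

Lemma winvK : involutive (@winv n).
Proof. by move=> w; rewrite !winvE map_rev revK mapK //; apply: linvK. Qed.

Lemma reduced_rev w : reduced (rev w) = reduced w.
Proof.
rewrite !reducedE rev_sorted; case: w => //= x w.
by apply: eq_path => y z; rewrite cancels_sym.
Qed.

Lemma reduced_winv w : reduced (winv w) = reduced w.
Proof.
rewrite winvE reduced_rev !reducedE sorted_map.
by case: w => //= x w; apply: eq_path => y z; rewrite /= cancels_linv.
Qed.

Lemma reduce_Vcat w : reduce (winv w ++ w) = [::].
Proof.
elim: w => // l w IHw; rewrite winv_cons -cats1 -catA reduce_cat.
have -> : reduce ([:: linv l] ++ l :: w) = reduce w.
  rewrite -[LHS]/(push (linv l) (push l (reduce w))) -{2}[l]linvK.
  by rewrite push_linvK // reduced_reduce.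
by rewrite -reduce_cat.
Qed.

End Words.

(** Elements are normal forms: equality in the group is equality of words and is decided by
    computation. *)
Record fgroup n := FGroup {fgword :> seq (letter n); _ : reduced fgword}.
HB.instance Definition _ n := [isSub for @fgword n].
HB.instance Definition _ n := [Choice of fgroup n by <:].

Section FreeGroup.
Variable n : nat.

Definition cls (w : word n) : fgroup n := FGroup (reduced_reduce w).

Lemma fgwordP (g : fgroup n) : reduced g.
Proof. by case: g. Qed.

Lemma clsK w : reduced w -> cls w = w :> word n.
Proof. exact: reduce_id. Qed.

Lemma fgwordK (g : fgroup n) : cls g = g.
Proof. by apply/val_inj/reduce_id/fgwordP. Qed.

Lemma eq_cls u v : cls u = cls v <-> reduce u = reduce v.
Proof. by split=> [/(congr1 val)|eq_uv] //; apply/val_inj. Qed.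

Lemma cls_inj u v : reduced u -> reduced v -> cls u = cls v -> u = v.
Proof. by move=> /reduce_id {2}<- /reduce_id {2}<- /eq_cls. Qed.

Definition fgmul (g h : fgroup n) := cls (g ++ h).
Definition fgone : fgroup n := cls [::].
Definition fginv (g : fgroup n) := cls (winv g).

Lemma cls_catl u v : cls (cls u ++ v) = cls (u ++ v).
Proof. by apply/val_inj; rewrite /= reduce_cat (reduce_id (reduced_reduce u)) -reduce_cat. Qed.

Lemma cls_catr u v : cls (u ++ cls v) = cls (u ++ v).
Proof. by apply/val_inj; rewrite /= reduce_cat (reduce_id (reduced_reduce v)) -reduce_cat. Qed.

Lemma fgmulA : associative fgmul.
Proof. by move=> g h k; rewrite /fgmul cls_catr cls_catl catA. Qed.
Lemma fgmul1 : left_id fgone fgmul.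
Proof. exact: fgwordK. Qed.
Lemma fgmulr1 : right_id fgone fgmul.
Proof. by move=> g; rewrite /fgmul cats0 fgwordK. Qed.
Lemma fgmulV : left_inverse fgone fginv fgmul.
Proof. by move=> g; rewrite /fgmul cls_catl; apply/val_inj; apply: reduce_Vcat. Qed.
Lemma fgmulrV : right_inverse fgone fginv fgmul.
Proof.
move=> g; rewrite /fgmul cls_catr; apply/val_inj.
by rewrite -{1}[fgword g]winvK; apply: reduce_Vcat.
Qed.

HB.instance Definition _ := isGroup.Build (fgroup n) fgmulA fgmul1 fgmulr1 fgmulV fgmulrV.

Lemma cls_cat u v : cls (u ++ v) = cls u * cls v.
Proof. by rewrite -cls_catl -cls_catr. Qed.

Lemma cls_nil : cls [::] = 1.
Proof. by []. Qed.

End FreeGroup.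

(** * Homomorphisms from a free group to an arbitrary group *)

Section Eval.
Variables (n : nat) (G : groupType).
Implicit Types (f : 'I_n -> G) (u v w : word n) (g h : fgroup n).

Definition evl f (l : letter n) : G := if l.2 then (f l.1)^-1 else f l.1.
Definition ev f w : G := foldr (fun l x => evl f l * x) 1 w.

Lemma ev_cons f l w : ev f (l :: w) = evl f l * ev f w. Proof. by []. Qed.

Lemma ev_cat f u v : ev f (u ++ v) = ev f u * ev f v.
Proof. by elim: u => [|l u IHu] /=; rewrite ?mul1g // IHu mulgA. Qed.

Lemma evl_linv f l : evl f (linv l) = (evl f l)^-1.
Proof. by case: l => i [] //=; rewrite /evl /= invgK. Qed.

Lemma ev_push f l w : ev f (push l w) = evl f l * ev f w.
Proof.
case: w => //= x w; rewrite cancelsE; case: eqP => [->|_] //.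
by rewrite evl_linv mulVKg.
Qed.

Lemma ev_reduce f w : ev f (reduce w) = ev f w.
Proof. by elim: w => //= l w IHw; rewrite -/(reduce w) (ev_push f l (reduce w)) IHw. Qed.

Lemma ev_cls f w : ev f (cls w) = ev f w.
Proof. exact: ev_reduce. Qed.

Lemma evM f g h : ev f (g * h) = ev f g * ev f h.
Proof. by rewrite ev_cls ev_cat. Qed.

Lemma evV f g : ev f (g^-1) = (ev f g)^-1.
Proof. by apply: (mulgI (ev f g)); rewrite -evM !mulgV. Qed.

Lemma ev_winv f w : ev f (winv w) = (ev f w)^-1.
Proof. by apply: (mulIg (ev f w)); rewrite -ev_cat -ev_reduce reduce_Vcat mulVg. Qed.

Lemma eq_ev f f' : f =1 f' -> ev f =1 ev f'.
Proof. by move=> eq_f; elim=> //= l w ->; rewrite /evl eq_f. Qed.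

End Eval.

Definition gen n (i : 'I_n) : fgroup n := cls [:: (i, false)].

Lemma evl_gen n (l : letter n) : evl (@gen n) l = cls [:: l].
Proof. by case: l => i []; apply/val_inj. Qed.

Lemma ev_gen n (w : word n) : ev (@gen n) w = cls w.
Proof. by elim: w => // l w IHw; rewrite ev_cons IHw evl_gen -cls_cat. Qed.

Lemma ev_genK n (g : fgroup n) : ev (@gen n) g = g.
Proof. by rewrite ev_gen fgwordK. Qed.

Lemma evl_morph n (G H : groupType) (phi : G -> H) (f : 'I_n -> G) :
  {morph phi : x y / x * y} -> forall l, phi (evl f l) = evl (phi \o f) l.
Proof.
move=> phiM; have phi1 : phi 1 = 1 by apply: (mulgI (phi 1)); rewrite -phiM !mulg1.
case=> i [] //=; rewrite /evl /=.
by apply: (mulgI (phi (f i))); rewrite -phiM !mulgV.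
Qed.

Lemma ev_morph n (G H : groupType) (phi : G -> H) (f : 'I_n -> G) (w : word n) :
  {morph phi : x y / x * y} -> phi (ev f w) = ev (phi \o f) w.
Proof.
move=> phiM; elim: w => [|l w IHw] /=.
  by apply: (mulgI (phi 1)); rewrite -phiM !mulg1.
by rewrite phiM IHw (evl_morph _ phiM).
Qed.

Lemma ev_comp n m (G : groupType) (f : 'I_m -> G) (h : 'I_n -> fgroup m) (w : word n) :
  ev f (ev h w) = ev (fun i => ev f (h i)) w.
Proof. by rewrite (ev_morph _ _ (evM f)). Qed.

Lemma ev_subst n m (G : groupType) (f : 'I_m -> G) (h : 'I_n -> word m) (w : word n) :
  ev f (subst h w) = ev (fun i => ev f (h i)) w.
Proof.
rewrite ev_reduce; elim: w => //= l w IHw; rewrite ev_cat IHw; congr (_ * _).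
by rewrite /evl; case: ifP => _ //; rewrite ev_winv.
Qed.

Lemma cls_subst n m (h : 'I_n -> word m) (w : word n) :
  cls (subst h w) = ev (fun i => cls (h i)) w.
Proof. by rewrite -ev_gen ev_subst; apply: eq_ev => i; rewrite ev_gen. Qed.

Lemma reduced_subst n m (h : 'I_n -> word m) (w : word n) : reduced (subst h w).
Proof. exact: reduced_reduce. Qed.

Lemma ev_relabel n m (G : groupType) (e : 'I_n -> 'I_m) (f : 'I_m -> G) (w : word n) :
  ev f (relabel e w) = ev (f \o e) w.
Proof. by elim: w => //= -[i s] w IHw; rewrite IHw /evl. Qed.

Lemma reduced_relabel n m (e : 'I_n -> 'I_m) (w : word n) :
  injective e -> reduced (relabel e w) = reduced w.
Proof.
move=> inj_e; rewrite !reducedE sorted_map; case: w => //= x w.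
by apply: eq_path => -[i s] [j t]; rewrite /= /cancels /= inj_eq.
Qed.

(** Surjectivity gives only the existence of preimages; decidable equality and choice on [fgroup]
    turn this into an inverse function. *)
Lemma is_autP n (f : 'I_n -> word n) :
  is_aut f <-> bijective (fun g : fgroup n => ev (fun i => cls (f i)) g).
Proof.
split=> [[inj_f surj_f]|[h hK Kh]].
  have surj g : exists h : fgroup n, ev (fun i => cls (f i)) h == g.
    have [u [red_u fu]] := surj_f _ (fgwordP g).
    exists (cls u); rewrite ev_cls -cls_subst -[g]fgwordK.
    by apply/eqP; rewrite fu.
  exists (fun g => xchoose (surj g)) => [g|g]; last exact: (eqP (xchooseP (surj g))).
  have := eqP (xchooseP (surj (ev (fun i => cls (f i)) g))).
  set g' := xchoose _ => eq_g; apply/val_inj/inj_f; try exact: fgwordP.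
  by apply: cls_inj; rewrite ?reduced_subst // !cls_subst.
split=> [u v red_u red_v eq_uv|v red_v].
  apply: cls_inj => //; apply: (can_inj hK) => /=.
  by rewrite !ev_cls -!cls_subst eq_uv.
exists (h (cls v)); split; first exact: fgwordP.
by apply: cls_inj; rewrite ?reduced_subst // cls_subst Kh.
Qed.

(** Both steps relate [m] and [m + 1], so one recursion such as [zpowS] serves in both
    directions. *)
Lemma zint_ind (P : int -> Prop) :
  P 0%R -> (forall m, P m -> P (m + 1)%R) -> (forall m, P (m + 1)%R -> P m) -> forall m, P m.
Proof.
move=> P0 PS PN; elim/int_ind=> // k Pk; first by rewrite -[k.+1]addn1 PoszD; apply: PS.
by apply: PN; rewrite -[k.+1]addn1 PoszD opprD subrK.
Qed.

Section IntPower.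
Variable G : groupType.
Implicit Types (x y : G) (m n : int).

Definition zpow x m : G := match m with Posz k => x ^+ k | Negz k => x ^- k.+1 end.

Lemma zpow0 x : zpow x 0%R = 1. Proof. by []. Qed.
Lemma zpow1 x : zpow x 1%R = x. Proof. by []. Qed.

Lemma zpowN1 x : zpow x (-1)%R = x^-1. Proof. by []. Qed.

Lemma zpowN x m : zpow x (- m)%R = (zpow x m)^-1.
Proof. by case: m => [[|k]|k] //=; rewrite ?invg1 // invgK. Qed.

Lemma zpowS x m : zpow x (m + 1)%R = zpow x m * x.
Proof.
case: m => [k|[|k]].
- by rewrite (_ : (Posz k + 1)%R = k.+1) ?addn1 //= ?expgSr //; lia.
- by rewrite (_ : (Negz 0 + 1)%R = 0) //= mulVg.
rewrite (_ : (Negz k.+1 + 1)%R = Negz k) /=; last by lia.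
by rewrite [x ^+ k.+2]expgS invgM mulgVK.
Qed.

Lemma zpowD x m n : zpow x (m + n)%R = zpow x m * zpow x n.
Proof.
elim/zint_ind: n => [|k IHk|k]; first by rewrite addr0 mulg1.
  by rewrite addrA !zpowS IHk mulgA.
by rewrite addrA !zpowS mulgA => /mulIg.
Qed.

Lemma zpow1g m : zpow (1 : G) m = 1.
Proof. by case: m => k /=; rewrite expg1n ?invg1. Qed.

Lemma zpowM x m n : zpow x (m * n)%R = zpow (zpow x m) n.
Proof.
elim/zint_ind: n => [|k IHk|k]; first by rewrite mulr0.
  by rewrite mulrDr mulr1 zpowS -IHk zpowD.
by rewrite mulrDr mulr1 zpowS zpowD => /mulIg.
Qed.

Lemma zpowJ x y m : zpow (x * y * x^-1) m = x * zpow y m * x^-1.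
Proof.
elim/zint_ind: m => [|k IHk|k]; first by rewrite mulg1 mulgV.
  by rewrite !zpowS IHk !mulgA mulgVK.
by rewrite !zpowS !mulgA => /mulIg/mulIg H; apply: (mulIg x); rewrite mulgVK.
Qed.

End IntPower.

Lemma zpow_morph (G H : groupType) (phi : G -> H) x m :
  {morph phi : x y / x * y} -> phi (zpow x m) = zpow (phi x) m.
Proof.
move=> phiM; have phi1 : phi 1 = 1 by apply: (mulgI (phi 1)); rewrite -phiM !mulg1.
have phiX k : phi (x ^+ k) = phi x ^+ k by elim: k => // k IHk; rewrite !expgS phiM IHk.
case: m => k //=; apply: (mulIg (phi (x ^+ k.+1))).
by rewrite -phiM mulVg phiX mulVg.
Qed.

Lemma ev_zpow n (G : groupType) (f : 'I_n -> G) (g : fgroup n) m :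
  ev f (zpow g m) = zpow (ev f g) m.
Proof. exact: (zpow_morph _ _ (evM f)). Qed.

(** * Magnus coefficients *)

Section Magnus.
Variable n : nat.
Implicit Types (l : letter n) (f g h : seq 'I_n -> int) (u : word n) (v w : seq 'I_n) (x y : fgroup n).
Local Open Scope ring_scope.

(* A letter acts on power series in noncommuting variables, given by their coefficients, as left
   multiplication by [1 + X_i] or by its inverse; [mag u w] is thus the coefficient of [w] in the Magnus
   expansion of [u]. *)
Definition macp (i : 'I_n) f w : int :=
  f w + (if w is j :: w' then if j == i then f w' else 0 else 0).
Fixpoint macn (i : 'I_n) f w : int :=
  f w - (if w is j :: w' then if j == i then macn i f w' else 0 else 0).
Definition mac l f := if l.2 then macn l.1 f else macp l.1 f.
Definition mag u : seq 'I_n -> int := foldr mac (fun w => (w == [::])%:R) u.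

Lemma eq_mac l f g : f =1 g -> mac l f =1 mac l g.
Proof.
case: l => i [] eq_fg w; rewrite /mac /=; last by rewrite /macp; case: w => [|j w]; rewrite !eq_fg.
by elim: w => [|j w IHw] /=; rewrite eq_fg ?IHw.
Qed.

Lemma mac_linvK l f : mac l (mac (linv l) f) =1 f.
Proof.
case: l => i [] w; rewrite /mac /linv /=.
  elim: w => [|j w IHw] /=; rewrite /macp ?IHw; first by ring.
  by rewrite addrK.
by rewrite /macp; case: w => [|j w] /=; [ring | rewrite subrK].
Qed.

Lemma mag_push l u : mag (push l u) =1 mag (l :: u).
Proof.
case: u => //= x u; rewrite cancelsE; case: eqP => //-> w.
by rewrite /= mac_linvK.
Qed.

Lemma mag_reduce u : mag (reduce u) =1 mag u.
Proof.
elim: u => //= l u IHu w; rewrite -/(reduce u).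
by rewrite -[LHS]/(mag (push l (reduce u)) w) mag_push /=; apply: eq_mac.
Qed.

(** The product of noncommutative power series: the sum of [f u * g v] over all factorisations of
    [w] as [u ++ v]. *)
Fixpoint conv f g w : int :=
  f [::] * g w + (if w is j :: w' then conv (fun v => f (j :: v)) g w' else 0).

Lemma eq_conv f f' g g' : f =1 f' -> g =1 g' -> conv f g =1 conv f' g'.
Proof.
move=> eq_f eq_g w; elim: w f f' eq_f => [|j w IHw] f f' eq_f /=; first by rewrite eq_f eq_g.
by rewrite eq_f eq_g (IHw _ (fun v => f' (j :: v))).
Qed.

Lemma conv_lin f f' (c : int) g w : conv (fun v => f v + c * f' v) g w = conv f g w + c * conv f' g w.
Proof.
elim: w f f' => [|j w IHw] f f' /=; first by ring.
by rewrite (IHw (fun v => f (j :: v)) (fun v => f' (j :: v))) /=; ring.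
Qed.

Lemma conv_macp i f g w : conv (macp i f) g w = macp i (conv f g) w.
Proof.
case: w => [|j w]; rewrite /macp /=; first by ring.
rewrite (@eq_conv _ (fun v => f (j :: v) + (j == i)%:R * f v) _ g) //; last first.
  by move=> v; case: eqP => _ /=; ring.
by rewrite conv_lin; case: eqP => _ /=; ring.
Qed.

Lemma conv_mac l f g : conv (mac l f) g =1 mac l (conv f g).
Proof.
case: l => i [] w; rewrite ?conv_macp //.
(* Multiplying by the invertible series 1 + X_i reduces the inverse letter to the positive one. *)
rewrite -[LHS](mac_linvK (i, true)); apply: eq_mac => v.
rewrite /linv /mac /= -conv_macp; apply: eq_conv => // t.
exact: (mac_linvK (i, false) f t).
Qed.

Lemma mag_cat u (v : word n) : mag (u ++ v) =1 conv (mag u) (mag v).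
Proof.
elim: u => [|l u IHu] w /=; last by rewrite conv_mac; apply: eq_mac.
case: w => [|j w] /=; rewrite mul1r ?addr0 //.
suff -> : conv (fun=> 0) (mag v) w = 0 by rewrite addr0.
by elim: w => [|k w IHw] /=; rewrite mul0r ?IHw addr0.
Qed.

Lemma magM (x y : fgroup n) : mag (x * y)%g =1 conv (mag x) (mag y).
Proof. by move=> w; rewrite mag_reduce mag_cat. Qed.

Lemma mag1 w : mag (1%g : fgroup n) w = (w == [::])%:R.
Proof. by []. Qed.

Lemma mag_nil u : mag u [::] = 1.
Proof.
elim: u => // -[i s] u; rewrite /= /mac /= /macp.
by case: s => /= ->.
Qed.

(** The linear coefficient is the exponent sum of the generator [i], a coordinate of the homology
    class. *)
Definition ex (i : 'I_n) (x : fgroup n) : int := mag x [:: i].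

Lemma exM i x y : ex i (x * y)%g = ex i x + ex i y.
Proof. by rewrite /ex magM /= !mag_nil; ring. Qed.

Lemma ex1 i : ex i 1%g = 0.
Proof. by []. Qed.

Lemma exV i x : ex i x^-1%g = - ex i x.
Proof. by apply/eqP; rewrite -addr_eq0 -exM mulVg ex1. Qed.

Lemma ex_zpow i x m : ex i (zpow x m) = m * ex i x.
Proof.
elim/zint_ind: m => [|k IHk|k]; first by rewrite mul0r.
  by rewrite zpowS exM IHk mulrDl mul1r.
by rewrite zpowS exM mulrDl mul1r => /addIr.
Qed.

Lemma ex_gen i j : ex i (gen j) = (i == j)%:R.
Proof. by rewrite /ex /gen mag_reduce /= /mac /= /macp /= eq_sym; case: eqP. Qed.

Lemma mag2M i j (x y : fgroup n) :
  mag (x * y)%g [:: i; j] = mag x [:: i; j] + ex i x * ex j y + mag y [:: i; j].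
Proof. by rewrite magM /= !mag_nil /ex; ring. Qed.

(** Doubling avoids a division in the binomial coefficient m(m-1)/2. *)
Lemma mag2_zpow i j x m :
  2 * mag (zpow x m) [:: i; j] = 2 * m * mag x [:: i; j] + m * (m - 1) * ex i x * ex j x.
Proof.
elim/zint_ind: m => [|k IHk|k IHk].
- by rewrite zpow0 mag1 /=; ring.
- by rewrite zpowS mag2M mulrDr mulrDr IHk ex_zpow; ring.
move: IHk; rewrite zpowS mag2M ex_zpow => IHk.
apply: (@addIr _ (2 * (k * ex i x * ex j x) + 2 * mag x [:: i; j])).
by rewrite addrA -!mulrDr IHk; ring.
Qed.

(** As [w] does not start with [l.1], only the constant and linear terms of the series of the
    syllable can contribute. *)
Lemma mag_nseq_cat l m u w : ohead w != Some l.1 ->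
  mag (nseq m l ++ u) w = mag u w /\ mag (nseq m l ++ u) (l.1 :: w) = mag u (l.1 :: w) + (-1) ^+ l.2 * m%:Z * mag u w.
Proof.
move=> hd_w; elim: m => [|m [IH1 IH2]]; first by split=> //=; ring.
have step f : mac l f w = f w.
  rewrite /mac; case: w hd_w {IH1 IH2} => [|j w] hd_w.
    by case: ifP => _; rewrite /= /macp ?subr0 ?addr0.
  have /negPf neq_j : j != l.1 by apply: contraNneq hd_w => ->.
  by case: ifP => _; rewrite /= /macp neq_j ?subr0 ?addr0.
split=> /=; first by rewrite step.
rewrite -[m.+1]addn1 PoszD.
case: l hd_w IH1 IH2 step => i [] /= hd_w IH1 IH2 step; rewrite /mac /= /macp eqxx IH2.
  by have := step (mag (nseq m (i, true) ++ u)); rewrite /mac /= => ->; rewrite IH1; ring.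
by rewrite IH1; ring.
Qed.

Definition alternating w := sorted (fun i j => i != j) w.

Lemma syllable l u : reduced (l :: u) ->
  exists m (h : word n), [/\ l :: u = nseq m.+1 l ++ h, reduced h & omap fst (ohead h) != Some l.1].
Proof.
elim: u l => [|x u IHu] l red_lxu; first by exists 0, [::].
have [/eqP eq_i|neq_i] := boolP (x.1 == l.1); last first.
  by exists 0, (x :: u); split; rewrite ?(reduced_cons red_lxu).
have eq_x : x = l.
  move: red_lxu; rewrite /= /cancels eq_i eqxx negbK => /andP[/eqP eq_s _].
  by rewrite [x]surjective_pairing eq_i -eq_s -surjective_pairing.
have [m [h [eq_u red_h hd_h]]] := IHu x (reduced_cons red_lxu).
by exists m.+1, h; split; rewrite ?eq_u // eq_x in hd_h *.
Qed.

(** Magnus's argument. The witness lists the generators of the syllables of [u], and its coefficient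
    is the product of their exponents. The vanishing on longer alternating words carries the
    induction: it removes the second contribution to the new coefficient. *)
Lemma mag_faithful_aux u : reduced u -> exists w,
  [/\ alternating w, ohead w = omap fst (ohead u), mag u w != 0 &
      forall w', alternating w' -> (size w < size w')%N -> mag u w' = 0].
Proof.
have [k] := ubnP (size u); elim: k u => // k IHk [|l u] lt_uk red_u.
  by exists [::]; split=> // -[].
have [m [h [eq_u red_h hd_h]]] := syllable red_u.
have lt_hk : (size h < k)%N.
  by move: lt_uk; rewrite eq_u size_cat size_nseq; lia.
have [w [alt_w hd_w nz_w top_w]] := IHk h lt_hk red_h.
rewrite -hd_w in hd_h.
have alt_lw : alternating (l.1 :: w).
  by case: w alt_w hd_h {hd_w nz_w top_w} => //= j w -> /eqP; rewrite andbT => H; apply/eqP => e; case: H; rewrite e.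
exists (l.1 :: w); rewrite eq_u.
have := mag_nseq_cat m.+1 h hd_h => -[_ ->].
split=> //.
  rewrite top_w // add0r !mulf_neq0 // ?signr_eq0 //.
move=> [|j w'] // alt_w' lt_ww'.
have [eq_j|neq_j] := eqVneq j l.1.
  rewrite eq_j in alt_w' *.
  have hd_w' : ohead w' != Some l.1.
    by case: w' alt_w' {lt_ww'} => //= i w' /andP[/eqP neq _]; apply/eqP => -[/esym].
  have := mag_nseq_cat m.+1 h hd_w' => -[_ ->].
  rewrite !top_w ?mulr0 ?addr0 //; last exact: ltnW.
  by move: alt_w'; case: (w') => //= i t /andP[].
have hd_j : ohead (j :: w') != Some l.1 by apply/eqP => -[/eqP]; apply/negP.
have := mag_nseq_cat m.+1 h hd_j => -[-> _].
by rewrite top_w // ltnW.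
Qed.

Lemma mag_faithful (x : fgroup n) : (forall w, mag x w = (w == [::])%:R) -> x = 1%g.
Proof.
move=> mag_x; apply/val_inj; have [w [_ hd_w nz_w _]] := mag_faithful_aux (fgwordP x).
rewrite mag_x in nz_w; case: w nz_w hd_w => //.
by rewrite /=; case: (fgword x).
Qed.

Lemma mag_inj (x y : fgroup n) : mag x =1 mag y -> x = y.
Proof.
move=> eq_xy; apply/eqP; rewrite -divg_eq1; apply/eqP/mag_faithful => w.
rewrite magM (eq_conv eq_xy (frefl _)) -magM mulgV.
by rewrite mag1.
Qed.

(** Equal neighbours in [w] would bring in binomial coefficients; an alternating word sees a power
    only through its constant and linear terms. *)
Lemma mag_zpow_gen i m w : alternating w ->
  mag (zpow (gen i) m) w = if w is [::] then 1 else if w is [:: j] then if j == i then m else 0 else 0.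
Proof.
move=> alt_w; 
have zpow_nseq k (s : bool) : zpow (gen i) ((-1) ^+ s * Posz k) = cls (nseq k (i, s)) :> fgroup n.
  elim: k => [|k IHk]; first by rewrite mulr0.
  rewrite -[k.+1]addn1 addnC PoszD mulrDr mulr1 zpowD IHk nseqD cls_cat.
  by congr (_ * _)%g; case: s {IHk}.
have [s [k def_m]] : exists s k, m = (-1) ^+ (s : bool) * Posz k.
  by case: m => k; [exists false, k | exists true, k.+1]; rewrite ?mul1r ?mulN1r ?NegzE.
rewrite def_m zpow_nseq mag_reduce -[nseq k _]cats0.
have nil_w (v : seq 'I_n) : mag [::] v = (v == [::])%:R by [].
case: w alt_w => [|j w] alt_w; first by rewrite mag_nil.
have [eq_j|neq_j] := eqVneq j i; last first.
  have hd_j : ohead (j :: w) != Some (i, s).1 by apply/eqP => -[/eqP]; apply/negP.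
  by have [-> _] := mag_nseq_cat k [::] hd_j; case: (w) => //.
rewrite eq_j in alt_w *.
have hd_w : ohead w != Some (i, s).1.
  by case: w alt_w => //= a w /andP[/eqP neq _]; apply/eqP => -[/esym].
have [_ ->] := mag_nseq_cat k [::] hd_w; rewrite !nil_w /=.
by case: (w) => [|a t] /=; ring.
Qed.

(** Only the factorisation of [w] with empty second factor sees the difference of [f] and [f']. This
    makes the increment [d] in [IA_torsion_trivial] additive. *)
Lemma conv_diff f f' h h' w :
  (forall v, (size v < size w)%N -> f v = f' v) ->
  (forall v, (size v <= size w)%N -> h v = h' v) ->
  conv f h w - conv f' h' w = (f w - f' w) * h [::].
Proof.
elim: w f f' => [|j w IHw] f f' eq_f eq_h /=.
  by rewrite (eq_h [::]) //; ring.
rewrite (eq_f [::]) // (eq_h (j :: w)) //.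
rewrite -(IHw (fun v => f (j :: v)) (fun v => f' (j :: v))) => [|v lt_v|v le_v].
- by ring.
- by apply: eq_f; rewrite ltnS.
by apply: eq_h; rewrite ltnW.
Qed.

(** Homomorphisms to the integers factor through homology. *)
Lemma additive_ex (d : fgroup n -> int) : (forall x y, d (x * y)%g = d x + d y) ->
  forall x, d x = \sum_i ex i x * d (gen i).
Proof.
move=> dM x; have d1 : d 1%g = 0 by apply: (@addIr _ (d 1%g)); rewrite -dM mulg1 add0r.
have dV y : d y^-1%g = - d y by apply/eqP; rewrite -addr_eq0 -dM mulVg d1.
rewrite -[x]ev_genK; elim: (fgword x) => [|[i s] u IHu] /=.
  by rewrite d1 big1 // => i _; rewrite mul0r.
rewrite dM IHu; under [RHS]eq_bigr do rewrite exM mulrDl.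
rewrite big_split /=; congr (_ + _).
have sum_i (c : int) : \sum_j (c * (j == i)%:R) * d (gen j) = c * d (gen i).
  rewrite (bigD1 i) //= big1 => [|j /negPf->]; last by rewrite mulr0 mul0r.
  by rewrite eqxx mulr1 addr0.
case: s; rewrite /evl /= ?dV.
  rewrite -mulN1r -sum_i; apply: eq_bigr => j _; rewrite exV ex_gen; ring.
by rewrite -[LHS]mul1r -sum_i; apply: eq_bigr => j _; rewrite ex_gen mul1r.
Qed.

(* The first Magnus coefficient changed by [s] would change additively under iteration of [s]. *)
Lemma IA_torsion_trivial (s : fgroup n -> fgroup n) :
  {morph s : x y / (x * y)%g} -> (forall i x, ex i (s x) = ex i x) ->
  (forall x, s (s (s (s x))) = s x) -> forall x, s x = x.
Proof.
move=> sM s_ia s4 x; apply: mag_inj => w; have [k] := ubnP (size w).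
elim: k x w => // k IHk x w; rewrite ltnS leq_eqVlt => /predU1P[def_k|/IHk] //.
pose d y := mag (s y) w - mag y w.
have dM y z : d (y * z)%g = d y + d z.
  rewrite /d sM !magM; case: w def_k {d} => [|j w] def_k; first by rewrite /= !mag_nil; ring.
  rewrite /= opprD addrACA conv_diff => [|v lt_v|v le_v]; try by apply: IHk; rewrite -def_k.
  by rewrite !mag_nil; ring.
have d_s y : d (s y) = d y.
  by rewrite (additive_ex dM) [RHS](additive_ex dM); apply: eq_bigr => i _; rewrite s_ia.
(* The increments along the cycle from [s x] through [s (s x)] and [s (s (s x))] back to [s x]
   telescope to zero, and each of them equals [d x]. *)
have : d (s (s (s x))) + d (s (s x)) + d (s x) = 0 by rewrite /d s4; ring.
by rewrite !d_s /d; lia.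
Qed.

End Magnus.

(** * Ping-pong in the free group of rank two *)

Section Overlap.
Variable n : nat.
Implicit Types (l x y : letter n) (u v c w : word n).

Lemma reduced_catl u v : reduced (u ++ v) -> reduced u.
Proof. by elim: u => // l [|x u] //= IHu /andP[-> /IHu]. Qed.

Lemma reduced_catr u v : reduced (u ++ v) -> reduced v.
Proof. by elim: u => //= l u IHu red_luv; apply/IHu/(reduced_cons red_luv). Qed.

Lemma reduced_overlap u c v :
  c != [::] -> reduced (u ++ c) -> reduced (c ++ v) -> reduced (u ++ c ++ v).
Proof.
move=> nz_c; elim: u => // l u IHu red_luc red_cv.
have := IHu (reduced_cons red_luc) red_cv; move: red_luc.
case: u {IHu} => [|y u] /=; last by move=> /andP[-> _].
by case: c nz_c red_cv => //= x w _ _ /andP[-> _].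
Qed.

Lemma reduced_join u y x v : reduced (rcons u y) -> ~~ cancels y x -> reduced (x :: v) ->
  reduced (rcons u y ++ x :: v).
Proof.
move=> red_uy can_yx red_xv; rewrite cat_rcons.
by apply: (@reduced_overlap u [:: y] (x :: v)); rewrite ?cats1 //= can_yx.
Qed.

(** Reducedness of [c ++ c] expresses that [c] is cyclically reduced; outer letters that cancel are
    moved into [u]. *)
Lemma cyclic_decomp w : reduced w -> w != [::] ->
  exists u c, [/\ w = u ++ c ++ winv u, c != [::] & reduced (c ++ c)].
Proof.
have [k] := ubnP (size w); elim: k w => // k IHk [|l w] // lt_wk red_w _.
case/lastP: w lt_wk red_w => [|w x] lt_wk red_w.
  by exists [::], [:: l]; split=> //=; rewrite /cancels !eqxx.
have [can_xl|can_xl] := boolP (cancels x l).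
  have nz_w : w != [::].
    by case: w red_w {lt_wk} => //=; rewrite cancels_sym can_xl.
  have red_w' : reduced w by move/reduced_cons: red_w; rewrite -cats1 => /reduced_catl.
  have lt_w : (size w < k)%N by move: lt_wk; rewrite /= size_rcons; lia.
  have [u [c [-> nz_c red_cc]]] := IHk w lt_w red_w' nz_w.
  exists (l :: u), c; split=> //; rewrite winv_cons.
  by move: can_xl; rewrite cancels_sym cancelsE => /eqP->; rewrite /= !rcons_cat.
exists [::], (l :: rcons w x); split; rewrite ?cats0 //.
by rewrite -rcons_cons; apply: reduced_join; rewrite ?rcons_cons.
Qed.

Lemma cls_power i w : all (fun l => l.1 == i) w -> exists m, cls w = zpow (gen i) m.
Proof.
elim: w => [|[j s] w IHw] /=; first by exists 0%R.
case/andP=> /eqP-> /IHw[m eq_w]; exists ((if s then -1 else 1) + m)%R.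
rewrite -cat1s cls_cat eq_w zpowD; congr (_ * _).
by case: s; rewrite ?zpow1 ?zpowN1 //; apply/val_inj.
Qed.

Lemma gen_nseq i k : cls (nseq k (i, false)) = zpow (gen i) k%:Z :> fgroup n.
Proof.
elim: k => // k IHk; rewrite -[k.+1]addn1 PoszD zpowS -IHk nseqD cls_cat.
by congr (_ * _).
Qed.

Lemma gen_nseqV i k : cls (nseq k (i, true)) = zpow (gen i) (- k%:Z)%R :> fgroup n.
Proof.
rewrite zpowN -gen_nseq; apply: (mulgI (cls (nseq k (i, false)))); rewrite mulgV -cls_cat.
have -> : nseq k (i, true) = winv (nseq k (i, false)).
  by rewrite winvE map_nseq rev_nseq.
apply/val_inj; rewrite -{1}[nseq k (i, false)]winvK; exact: reduce_Vcat.
Qed.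

Lemma zpow_word i m : zpow (gen i) m = cls (nseq `|m| (i, (m < 0)%R)) :> fgroup n.
Proof.
case: m => k; first by rewrite gen_nseq.
by rewrite gen_nseqV NegzE.
Qed.

End Overlap.

Local Notation a := (@gen 2 ga).
Local Notation b := (@gen 2 gb).

Definition fn2 T (U V : T) (i : 'I_2) : T := if i == ga then U else V.
(** This is W(U, V); for [U], [V] in [fgroup 2] it is the endomorphism of F2 with images [U] and
    [V]. *)
Definition app (G : groupType) (U V : G) (w : word 2) : G := ev (fn2 U V) w.

Lemma ord2P (i : 'I_2) : i = ga \/ i = gb.
Proof. by case: i => [[|[|k]] Hk] //; [left | right]; apply/val_inj. Qed.

Section App.
Variables (G : groupType) (U V : G).
Implicit Types g h : fgroup 2.

Lemma app_a : app U V a = U. Proof. by rewrite /app ev_cls /= /evl /= mulg1. Qed.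
Lemma app_b : app U V b = V. Proof. by rewrite /app ev_cls /= /evl /= mulg1. Qed.
Lemma appM g h : app U V (g * h) = app U V g * app U V h. Proof. exact: evM. Qed.
Lemma appV g : app U V g^-1 = (app U V g)^-1. Proof. exact: evV. Qed.
Lemma app_zpow g m : app U V (zpow g m) = zpow (app U V g) m. Proof. exact: ev_zpow. Qed.
Lemma app1 : app U V (1 : fgroup 2) = 1. Proof. by []. Qed.

Lemma app_app (P Q g : fgroup 2) : app U V (app P Q g) = app (app U V P) (app U V Q) g.
Proof. by rewrite /app ev_comp; apply: eq_ev => i; rewrite /fn2; case: ifP. Qed.
End App.

Lemma app_ab (g : fgroup 2) : app a b g = g.
Proof. by rewrite -[RHS]ev_genK; apply: eq_ev => i; case: (ord2P i) => ->. Qed.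

Lemma app_morph (G H : groupType) (phi : G -> H) (U V : G) (w : word 2) :
  {morph phi : x y / x * y} -> phi (app U V w) = app (phi U) (phi V) w.
Proof.
by move=> phiM; rewrite /app ev_morph //; apply: eq_ev => i /=; rewrite /fn2; case: ifP.
Qed.

Section PingPong.
Variables (M u c : word 2).
Hypotheses (redM : reduced M) (defM : M = u ++ c ++ winv u) (nz_c : c != [::]).
Hypothesis red_cc : reduced (c ++ c).
(** With [b]-letters at both ends, [M] cannot cancel against powers of [a]; between two adjacent
    copies only the conjugator [u] cancels. *)
Hypothesis hdM : omap fst (ohead M) = Some gb.
Hypothesis lastM : omap fst (ohead (rev M)) = Some gb.

Let img w := subst (fun2 [:: la] M) w.
Let pwr (s : bool) (w : word 2) := if s then winv w else w.

Let imgE l w : img (l :: w) = reduce ((if l.1 == ga then [:: l] else pwr l.2 M) ++ img w).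
Proof.
rewrite /img /subst /= [LHS]reduce_cat [RHS]reduce_cat (reduce_id (reduced_reduce (flatten _))).
by congr (reduce (_ ++ _)); rewrite /fun2; case: l => i []; case: (ord2P i) => ->.
Qed.

Let pwrM s : pwr s M = u ++ pwr s c ++ winv u.
Proof. by rewrite defM; case: s => //=; rewrite !winv_cat winvK catA. Qed.

Let red_pwrM s : reduced (pwr s M).
Proof. by case: s; rewrite /= ?reduced_winv. Qed.

Let red_pwrcc s : reduced (pwr s c ++ pwr s c).
Proof. by case: s; rewrite /= -?winv_cat ?reduced_winv. Qed.

Let nz_pwrc s : pwr s c != [::].
Proof. by case: s => //=; rewrite -size_eq0 /winv size_rev size_map size_eq0. Qed.

Let hd_pwrM s : omap fst (ohead (pwr s M)) = Some gb.
Proof. by case: s => //=; rewrite winvE -map_rev; case: (rev M) lastM => //= x w. Qed.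

Let last_pwrM s : exists w y, pwr s M = rcons w y /\ y.1 = gb.
Proof.
have: omap fst (ohead (rev (pwr s M))) = Some gb.
  by case: s => //=; rewrite winvE revK; case: (M) hdM => //= x w.
case/lastP: (pwr s M) => // w y; rewrite rev_rcons => -[eq_y].
by exists w, y.
Qed.

(* Since [c] is cyclically reduced, the prefix [u c] (or [u c^-1]) of an image survives every further
   multiplication by [a], [M] or their inverses. *)
Lemma pingpong l w : reduced (l :: w) ->
  if l.1 == ga then img (l :: w) = l :: img w
  else exists t, img (l :: w) = u ++ pwr l.2 c ++ t.
Proof.
have nba : (gb == ga) = false by [].
elim: w l => [|x w IHw] l red_lw.
  case: (ord2P l.1) => eq_l; rewrite imgE eq_l ?eqxx ?nba //.
  by exists (winv u); rewrite cats0 reduce_id // pwrM.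
have := IHw x (reduced_cons red_lw); have red_img : reduced (img (x :: w)) by apply: reduced_subst.
rewrite (imgE l); case: (ord2P l.1) => eq_l; rewrite eq_l ?eqxx ?nba.
  case: (ord2P x.1) => eq_x; rewrite eq_x ?eqxx ?nba.
    move=> img_x; rewrite img_x in red_img *.
    rewrite -[LHS]/(reduce (l :: x :: img w)); apply: reduce_id => /=.
    by move: red_lw => /= /andP[-> _].
  move=> [t img_x]; rewrite img_x in red_img *.
  rewrite -[LHS]/(reduce (l :: u ++ pwr x.2 c ++ t)); apply: reduce_id.
  have: omap fst (ohead (u ++ pwr x.2 c ++ t)) = Some gb.
    have := hd_pwrM x.2; rewrite pwrM; case: (u) => //.
    by have := nz_pwrc x.2; case: (pwr x.2 c).
  case: (u ++ _) red_img => // y r red_yr [eq_y].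
  by move: red_yr => /= ->; rewrite andbT /cancels eq_l eq_y.
case: (ord2P x.1) => eq_x; rewrite eq_x ?eqxx ?nba.
  move=> img_x; rewrite img_x in red_img *.
  exists (winv u ++ x :: img w); have := pwrM l.2; rewrite !catA => <-; apply: reduce_id.
  have [r [y [eq_r eq_y]]] := last_pwrM l.2.
  rewrite eq_r; apply: reduced_join => //; first by rewrite -eq_r.
  by rewrite /cancels eq_y eq_x.
(* Adjacent [b]-letters of a reduced word have the same sign, and u c u^-1 u c t = u c c t is
   reduced because [c] is cyclically reduced. *)
move=> [t img_x]; exists (pwr l.2 c ++ t).
have eq_s : x.2 = l.2.
  by move: red_lw; rewrite /= /cancels eq_l eq_x /= negbK => /andP[/eqP].
rewrite eq_s in img_x; rewrite img_x in red_img *.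
have red_uc : reduced (u ++ pwr l.2 c).
  by have := red_pwrM l.2; rewrite pwrM catA => /reduced_catl.
have red_uccs : reduced (u ++ pwr l.2 c ++ pwr l.2 c ++ t).
  apply: reduced_overlap => //; apply: reduced_overlap => //.
  exact: reduced_catr red_img.
rewrite -[RHS](reduce_id red_uccs); apply/eq_cls.
have cls_uV : cls (winv u) = (cls u)^-1.
  by rewrite -ev_gen ev_winv ev_gen.
by rewrite pwrM !cls_cat cls_uV -!mulgA mulKg.
Qed.

Lemma img_neq_nil w : reduced w -> w != [::] -> img w != [::].
Proof.
case: w => // l w /pingpong; case: ifP => [_ -> //|_ [t ->] _].
by have := nz_pwrc l.2; case: (u) => //; case: (pwr _ c).
Qed.

(** The surviving prefix [u c] or [u c^-1] already shows all letters of [M] up to inversion. *)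
Lemma img_power_b w k s : reduced w -> w != [::] -> img w = nseq k (gb, s) ->
  all (fun l => l.1 == gb) M.
Proof.
case: w => // l w /pingpong; case: ifP => [/eqP eq_l -> _|_ [t ->] _].
  by case: k => //= k [eq_l'] _; rewrite eq_l' in eq_l.
move=> eq_k; have: all (fun l => l.1 == gb) (u ++ pwr l.2 c ++ t) by rewrite eq_k all_nseq eqxx orbT.
rewrite !all_cat => /and3P[all_u all_c _]; rewrite defM !all_cat all_u winvE all_rev all_map.
rewrite (eq_all (a2 := fun l => l.1 == gb)) // all_u andbT.
by move: all_c; case: l.2 => //=; rewrite winvE all_rev all_map.
Qed.
End PingPong.

Lemma reduced_nseq n k (l : letter n) : reduced (nseq k l).
Proof.
by case: k => //= k; elim: k => //= k ->; rewrite /cancels !eqxx.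
Qed.

Lemma cls_reduced_power (w : word 2) n : cls w = zpow b n -> reduced w ->
  exists k s, w = nseq k (gb, s).
Proof.
rewrite zpow_word => eq_w red_w; exists `|n|%N, (n < 0)%R.
by apply: cls_inj; rewrite ?reduced_nseq.
Qed.

Lemma trim_left (v : word 2) : exists p m, [/\ v = p ++ m, all (fun l => l.1 == ga) p &
  m = [::] \/ omap fst (ohead m) = Some gb].
Proof.
elim: v => [|l v [p [m [-> all_p hd_m]]]]; first by exists [::], [::]; split=> //; left.
case: (ord2P l.1) => eq_l; first by exists (l :: p), m; rewrite /= eq_l.
by exists [::], (l :: p ++ m); split=> //; right; rewrite /= eq_l.
Qed.

Lemma trim (v : word 2) : exists p m r,
  [/\ v = p ++ m ++ r, all (fun l => l.1 == ga) p, all (fun l => l.1 == ga) r &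
  m = [::] \/ omap fst (ohead m) = Some gb /\ omap fst (ohead (rev m)) = Some gb].
Proof.
have [p [m [-> all_p hd_m]]] := trim_left v.
have [r [m' [eq_m all_r hd_m']]] := trim_left (rev m).
exists p, (rev m'), (rev r); split=> //; first by rewrite -rev_cat -eq_m revK.
  by rewrite all_rev.
case: hd_m' => [->|hd_m']; [by left | right]; split; last by rewrite revK.
have def_m : m = rev m' ++ rev r by rewrite -rev_cat -eq_m revK.
case: hd_m => [m0|]; first by move: hd_m' eq_m; rewrite m0; case: (r) (m') => [|? ?] [|? ?].
rewrite def_m; case/lastP: m' hd_m' {eq_m def_m} => // m' x _.
by rewrite rev_rcons.
Qed.

Lemma app_subst (A B : fgroup 2) (w : word 2) : app A B w = cls (subst (fun2 A B) w).
Proof. by rewrite cls_subst; apply: eq_ev => i; rewrite /fn2 /fun2; case: ifP; rewrite fgwordK. Qed.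

Lemma app_trimmed (M g : fgroup 2) : M != 1 ->
  omap fst (ohead M) = Some gb -> omap fst (ohead (rev M)) = Some gb -> g != 1 ->
  app a M g != 1 /\ forall n, app a M g = zpow b n -> exists m, M = zpow b m.
Proof.
move=> nz_M hdM lastM nz_g.
have nzM : (M : word 2) != [::] by apply: contraNneq nz_M => M0; apply/eqP/val_inj.
have nzg : (g : word 2) != [::] by apply: contraNneq nz_g => g0; apply/eqP/val_inj.
have [u [c [defM nz_c red_cc]]] := cyclic_decomp (fgwordP M) nzM.
have img_M : app a M g = cls (subst (fun2 [:: la] M) g) := app_subst a M g.
have red_img : reduced (subst (fun2 [:: la] M) g) by apply: reduced_subst.
split=> [|n]; rewrite img_M.
  have := img_neq_nil (fgwordP M) defM nz_c red_cc hdM lastM (fgwordP g) nzg.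
  by apply: contraNneq => /(congr1 val) /=; rewrite reduce_id // => ->.
move=> /cls_reduced_power-/(_ red_img)[k [s eq_img]].
have all_b := img_power_b (fgwordP M) defM nz_c red_cc hdM lastM (fgwordP g) nzg eq_img.
by have [m eq_m] := cls_power all_b; exists m; rewrite -eq_m fgwordK.
Qed.

(** The map a -> a, b -> a^p b a^r is an automorphism, so powers of [a] at the ends of a word can be
    moved into the argument [g], leaving a trimmed [M] for ping-pong. *)
Lemma app_twist (p r : int) (M g : fgroup 2) :
  app a (zpow a p * M * zpow a r) g = app a M (app a (zpow a p * b * zpow a r) g).
Proof. by rewrite app_app !appM !app_zpow app_a app_b. Qed.

Lemma app_twist_eq1 (p r : int) (g : fgroup 2) : app a (zpow a p * b * zpow a r) g = 1 -> g = 1.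
Proof.
move=> /(congr1 (fun x : fgroup 2 => app a (zpow a (- p) * b * zpow a (- r)) x)).
rewrite app_app !appM !app_zpow app_a app_b app1.
by rewrite !zpowN !mulgA mulgV mul1g mulgVK app_ab.
Qed.

(** Trim [V] to a^p M a^r. If [M] is empty, the value has exponent sum 0 in [b], against [n != 0];
    otherwise twist the argument and let ping-pong show that [M] is a power of [b]. *)
Lemma app_eq_power_b (V g : fgroup 2) n : n != 0%R -> app a V g = zpow b n ->
  exists p m r, m != 0%R /\ V = zpow a p * zpow b m * zpow a r.
Proof.
move=> nz_n app_g.
have [p [m [r [defV all_p all_r hd_m]]]] := trim V.
have [p' eq_p] := cls_power all_p; have [r' eq_r] := cls_power all_r.
have eV : V = zpow a p' * cls m * zpow a r' by rewrite -[V]fgwordK defV !cls_cat eq_p eq_r mulgA.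
have red_m : reduced m by have := fgwordP V; rewrite defV => /reduced_catr/reduced_catl.
have exb (q : int) : ex gb (zpow b q) = q by rewrite ex_zpow ex_gen mulr1.
case: hd_m => [m0|[hd_m last_m]].
  move: app_g; rewrite eV m0 cls_nil mulg1 -zpowD => app_g.
  have: ex gb (app a (zpow a (p' + r')) g) = 0%R.
    rewrite /app -[g]ev_genK ev_gen ev_cls; elim: (fgword g) => // l w IHw.
    rewrite ev_cons exM IHw addr0 /evl /fn2.
    by case: ifP; case: ifP => _ _; rewrite ?exV ?ex_zpow ?ex_gen ?mulr0 ?oppr0.
  by rewrite app_g exb => /eqP; rewrite (negPf nz_n).
rewrite eV app_twist in app_g; set g' := app a _ g in app_g.
have nz_g' : g' != 1.
  apply: contraNneq nz_n => g'1; move: app_g; rewrite g'1 app1 => /(congr1 (ex gb)).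
  by rewrite exb ex1 => <-.
have fgm : fgword (cls m) = m by apply: clsK.
have nz_m : cls m != 1.
  by apply/eqP => /(congr1 val) /=; rewrite reduce_id // => m0; rewrite m0 in hd_m.
have [|//|_ powM] := app_trimmed nz_m _ _ nz_g'; rewrite ?fgm //.
have [k eq_k] := powM n app_g.
exists p', k, r'; split; last by rewrite eV eq_k.
by apply: contraNneq nz_m => k0; rewrite eq_k k0.
Qed.

(** The endomorphism is the twist by [a^p], [a^r], which is injective, followed by b -> b^m, which
    is injective by ping-pong. *)
Lemma app_shape_inj (p m r : int) (g h : fgroup 2) : m != 0%R ->
  app a (zpow a p * zpow b m * zpow a r) g = app a (zpow a p * zpow b m * zpow a r) h -> g = h.
Proof.
move=> nz_m eq_gh; apply/eqP; rewrite -divg_eq1; apply/eqP/(@app_twist_eq1 p r).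
have: app a (zpow a p * zpow b m * zpow a r) (g * h^-1) = 1 by rewrite appM appV eq_gh mulgV.
rewrite app_twist => app1g; apply/eqP; apply: contra_eqT app1g => nz_gh.
have zm : zpow b m = nseq `|m| (gb, (m < 0)%R) :> word 2.
  by rewrite zpow_word clsK // reduced_nseq.
have [k def_k] : exists k, `|m|%N = k.+1 by case: `|m|%N (absz_eq0 m) nz_m => [<-|k] //; exists k.
have nz_bm : zpow b m != 1.
  by apply: contraNneq nz_m => /(congr1 (ex gb)); rewrite ex_zpow ex_gen mulr1 ex1 => ->.
by have [||] := app_trimmed nz_bm _ _ nz_gh; rewrite ?zm ?def_k ?rev_nseq.
Qed.

(** * Normal forms with respect to the last generator *)

Lemma ord3P (i : 'I_3) : [\/ i = x1, i = x2 | i = x3].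
Proof.
by case: i => [[|[|[|k]]] Hk] //; [constructor 1 | constructor 2 | constructor 3]; apply/val_inj.
Qed.

Section Pieces.
Variables A B : fgroup 2.
Hypothesis inj_AB : forall p : fgroup 2, app A B p = 1 -> p = 1.

Let tau (p : word 2) := subst (fun2 A B) p.
Let s1 (i : 'I_3) : word 3 :=
  if i == x1 then relabel e12 A else if i == x2 then relabel e12 B else [:: (i, false)].

Let inj_e12 : injective e12.
Proof. by move=> i j; case: (ord2P i) => ->; case: (ord2P j) => ->. Qed.

Let s1_relabel p : subst s1 (relabel e12 p) = relabel e12 (tau p).
Proof.
apply: cls_inj; rewrite ?reduced_subst ?reduced_relabel ?reduced_subst //.
rewrite -!ev_gen ev_subst !ev_relabel ev_subst; apply: eq_ev => i /=.
by case: (ord2P i) => ->; rewrite /s1 /fun2 /= ev_relabel.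
Qed.

Let tau_nil p : reduced p -> tau p = [::] -> p = [::].
Proof.
move=> red_p tau_p; have /(congr1 val) : cls p = 1; last by rewrite /= reduce_id.
by apply: inj_AB; rewrite /app ev_cls -/(app A B p) app_subst -/(tau p) tau_p.
Qed.

Lemma split_x3 (w : word 3) : exists p r, w = relabel e12 p ++ r /\
  (r = [::] \/ exists s r', r = (x3, s) :: r').
Proof.
elim: w => [|[i s] w [p [r [-> hd_r]]]]; first by exists [::], [::]; split=> //; left.
case: (ord3P i) => ->; first by exists ((ga, s) :: p), r.
  by exists ((gb, s) :: p), r.
exists [::], ((x3, s) :: relabel e12 p ++ r); split=> //; right.
by exists s, (relabel e12 p ++ r).
Qed.

(** Injectivity of tau keeps nonempty pieces nonempty, so the letters [x3] still separate the images
    and nothing cancels across them. *)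
Lemma subst_pieces w p r : reduced w -> w = relabel e12 p ++ r ->
  (r = [::] -> subst s1 w = relabel e12 (tau p)) /\
  (forall s w', r = (x3, s) :: w' -> subst s1 w = relabel e12 (tau p) ++ (x3, s) :: subst s1 w').
Proof.
have [k] := ubnP (size w); elim: k w p r => // k IHk w p r lt_wk red_w def_w.
split=> [r0|s w' def_r]; first by rewrite def_w r0 cats0 s1_relabel.
have red_xw' : reduced ((x3, s) :: w') by move: red_w; rewrite def_w def_r => /reduced_catr.
have red_w' := reduced_cons red_xw'.
have red_p : reduced p.
  by move: red_w; rewrite def_w => /reduced_catl; rewrite reduced_relabel.
have lt_w' : (size w' < k)%N.
  by rewrite -ltnS; apply: leq_trans lt_wk; rewrite def_w def_r size_cat /= addnS !ltnS leq_addl.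
(* If the next piece [p'] is empty, the next letter (if any) is the old [x3], where [w] is reduced;
   otherwise the image of [p'] starts with a letter over [x1], [x2]. *)
have red_xs : reduced ((x3, s) :: subst s1 w').
  have [p' [r' [def_w' hd_r']]] := split_x3 w'.
  have [IH1 IH2] := IHk w' p' r' lt_w' red_w' def_w'.
  have red_p' : reduced p'.
    by move: red_w'; rewrite def_w' => /reduced_catl; rewrite reduced_relabel.
  have := reduced_subst s1 w'.
  have [p'0|nz_p'] := eqVneq p' [::].
    case: hd_r' => [r'0|[t [w'' def_r']]]; first by rewrite (IH1 r'0) p'0.
    rewrite (IH2 _ _ def_r') p'0 /= => ->; rewrite andbT.
    by move: red_xw'; rewrite def_w' p'0 def_r' /= => /andP[].
  have: tau p' != [::] by apply: contraNneq nz_p' => /(tau_nil red_p')->.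
  case def_q: (tau p') => [|l q] // _.
  have: exists t, subst s1 w' = (e12 l.1, l.2) :: t.
    case: hd_r' => [r'0|[t [w'' def_r']]].
      by rewrite (IH1 r'0) def_q; exists (relabel e12 q).
    by rewrite (IH2 _ _ def_r') def_q /=; eexists.
  by case=> t -> /= ->; rewrite andbT /cancels /=; case: (ord2P l.1) => ->.
have red_new : reduced (relabel e12 (tau p) ++ (x3, s) :: subst s1 w').
  have red_tp : reduced (relabel e12 (tau p)) by rewrite reduced_relabel // reduced_subst.
  case/lastP: (tau p) red_tp => [|q l] // red_tp.
  have eq_q : relabel e12 (rcons q l) = rcons (relabel e12 q) (e12 l.1, l.2).
    by rewrite /relabel map_rcons.
  rewrite eq_q in red_tp *; apply: reduced_join => //.
  by rewrite /cancels /=; case: (ord2P l.1) => ->.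
apply: cls_inj; rewrite ?reduced_subst // def_w def_r.
rewrite -s1_relabel -[_ :: _](cat1s (x3, s)) -[(x3, s) :: subst s1 w']cat1s.
rewrite !cls_cat !cls_subst !ev_cat; congr (_ * (_ * _)).
by rewrite /= mulg1 /evl /s1 /=; case: s {def_r red_xw' red_xs red_new}; apply/val_inj.
Qed.

Lemma cat_x3_inj p q r r' (w w' : word 3) :
  relabel e12 p ++ (x3, r) :: w = relabel e12 q ++ (x3, r') :: w' -> p = q /\ w = w'.
Proof.
elim: p q => [|[i s] p IHp] [|[j t] q] /=.
- by case=> _ ->.
- by case: (ord2P j) => ->.
- by case: (ord2P i) => ->.
by case=> /inj_e12-> -> /IHp[-> ->].
Qed.

(** Uniqueness of the normal form makes every piece of a fixed word fixed, hence killed by [h]; only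
    the letters [x3] survive. *)
Lemma fixed_pieces (G : groupType) (h : 'I_3 -> G) (w : word 3) :
  (forall p : fgroup 2, app A B p = p -> ev (h \o e12) p = 1) ->
  reduced w -> subst s1 w = w -> exists e, ev h w = zpow (h x3) e.
Proof.
move=> kill; have [k] := ubnP (size w); elim: k w => // k IHk w lt_wk red_w fix_w.
have [p [r [def_w hd_r]]] := split_x3 w.
have [S1 S2] := subst_pieces red_w def_w.
have red_p : reduced p.
  by move: red_w; rewrite def_w => /reduced_catl; rewrite reduced_relabel.
have killp : tau p = p -> ev (h \o e12) p = 1.
  move=> tau_p; rewrite -(ev_cls _ p); apply: kill.
  by rewrite /app ev_cls -/(app A B p) app_subst -/(tau p) tau_p.
case: hd_r => [r0|[s [w' def_r]]].
  exists 0%R; rewrite def_w r0 cats0 ev_relabel; apply: killp.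
  move: fix_w; rewrite (S1 r0) def_w r0 cats0; apply: inj_map => -[i s] [j t].
  by case=> /inj_e12-> ->.
move: fix_w; rewrite (S2 _ _ def_r) def_w def_r => /cat_x3_inj[tau_p fix_w'].
have red_w' : reduced w'.
  by move: red_w; rewrite def_w def_r => /reduced_catr/reduced_cons.
have lt_w' : (size w' < k)%N.
  by rewrite -ltnS; apply: leq_trans lt_wk; rewrite def_w def_r size_cat /= addnS !ltnS leq_addl.
have [e ev_w'] := IHk w' lt_w' red_w' fix_w'.
exists ((if s then -1 else 1) + e)%R.
rewrite ev_cat ev_relabel killp // mul1g ev_cons ev_w' zpowD.
by congr (_ * _); case: s {def_r}.
Qed.

End Pieces.

(** * The braid relation in arbitrary groups *)

Definition fn3 T (x y z : T) (i : 'I_3) : T := if i == x1 then x else if i == x2 then y else z.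

Definition braid_eqs (A B C D : word 2) (G : groupType) (x y z : G) :=
  [/\ app (app x y A) (app (app x y B) z C) A = app x (app y z C) A,
      app (app x y A) (app (app x y B) z C) B = app (app x (app y z C) B) (app y z D) C &
      app (app x y B) z D = app (app x (app y z C) B) (app y z D) D].

Lemma ev_s1f (A B C D : word 2) (G : groupType) (x y z : G) i :
  ev (fn3 x y z) (s1f (A, B, C, D) i) = fn3 (app x y A) (app x y B) z i.
Proof.
case: (ord3P i) => ->; rewrite /s1f /= ?ev_relabel.
- by apply: eq_ev => j; case: (ord2P j) => ->.
- by apply: eq_ev => j; case: (ord2P j) => ->.
by rewrite /evl /= mulg1.
Qed.

Lemma ev_s2f (A B C D : word 2) (G : groupType) (x y z : G) i :
  ev (fn3 x y z) (s2f (A, B, C, D) i) = fn3 x (app y z C) (app y z D) i.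
Proof.
case: (ord3P i) => ->; rewrite /s2f /= ?ev_relabel.
- by rewrite /evl /= mulg1.
- by apply: eq_ev => j; case: (ord2P j) => ->.
by apply: eq_ev => j; case: (ord2P j) => ->.
Qed.

(** Quantifying over all groups and triples is the universal property of F3 built into the
    definition, ready for specialisation. *)
Definition local_rep (A B C D : fgroup 2) : Prop :=
  [/\ bijective (app A B : fgroup 2 -> fgroup 2), bijective (app C D : fgroup 2 -> fgroup 2) &
      forall (G : groupType) (x y z : G), braid_eqs A B C D x y z].

Definition quad_of (A B C D : fgroup 2) : quad := (fgword A, fgword B, fgword C, fgword D).

Lemma is_aut_app (A B : fgroup 2) : is_aut (fun2 A B) <-> bijective (app A B : fgroup 2 -> fgroup 2).
Proof. by rewrite is_autP; split=> /eq_bij; apply=> g; rewrite app_subst cls_subst. Qed.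

Lemma local_repP (A B C D : fgroup 2) : local_braid_rep (quad_of A B C D) <-> local_rep A B C D.
Proof.
rewrite /local_braid_rep /quad_of !is_aut_app.
have evE (G : groupType) (x y z : G) i :
   (ev (fn3 x y z) (subst (s1f (quad_of A B C D)) (subst (s2f (quad_of A B C D))
      (s1f (quad_of A B C D) i))) =
    fn3 (app (app x y A) (app (app x y B) z C) A) (app (app x y A) (app (app x y B) z C) B)
        (app (app x y B) z D) i) /\
   (ev (fn3 x y z) (subst (s2f (quad_of A B C D)) (subst (s1f (quad_of A B C D))
      (s2f (quad_of A B C D) i))) =
    fn3 (app x (app y z C) A) (app (app x (app y z C) B) (app y z D) C)
        (app (app x (app y z C) B) (app y z D) D) i).
  split.
    by rewrite ev_subst (eq_ev (ev_s1f _ _ _ _ x y z)) ev_subst (eq_ev (ev_s2f _ _ _ _ _ _ _)) ev_s1f.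
  by rewrite ev_subst (eq_ev (ev_s2f _ _ _ _ x y z)) ev_subst (eq_ev (ev_s1f _ _ _ _ _ _ _)) ev_s2f.
rewrite /quad_of in evE; split=> [[autAB [autCD braid]]|[autAB autCD braid]].
  split=> // G x y z; split.
  - by have [E1 E2] := evE G x y z Defs.x1; move: E1; rewrite braid E2.
  - by have [E1 E2] := evE G x y z Defs.x2; move: E1; rewrite braid E2.
  by have [E1 E2] := evE G x y z Defs.x3; move: E1; rewrite braid E2.
split=> //; split=> // i; apply: cls_inj; rewrite ?reduced_subst // -!ev_gen.
have gen3 : @gen 3 =1 fn3 (gen x1) (gen x2) (gen x3) by move=> j; case: (ord3P j) => ->.
rewrite !(eq_ev gen3).
have [-> ->] := evE _ (gen x1) (gen x2) (gen x3) i.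
by have [-> -> ->] := braid _ (gen x1) (gen x2) (gen x3).
Qed.

(** * Symmetries *)

(** Triples in [G] are the homomorphisms from F3 to [G]; s1 and s2 act on them by precomposition.
    The inverse symmetry then amounts to cancelling bijections. *)
Definition act1 (A B : word 2) (G : groupType) (t : G * G * G) : G * G * G :=
  (app t.1.1 t.1.2 A, app t.1.1 t.1.2 B, t.2).
Definition act2 (C D : word 2) (G : groupType) (t : G * G * G) : G * G * G :=
  (t.1.1, app t.1.2 t.2 C, app t.1.2 t.2 D).

Lemma braid_eqsE (A B C D : word 2) (G : groupType) (x y z : G) :
  braid_eqs A B C D x y z <->
  act1 A B (act2 C D (act1 A B (x, y, z))) = act2 C D (act1 A B (act2 C D (x, y, z))).
Proof. by split=> [[E1 E2 E3]|[E1 E2 E3]]; [congr (_, _, _) | split]. Qed.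

Lemma bij_of_inverse (A B A' B' : fgroup 2) :
  app A B A' = a -> app A B B' = b -> app A' B' A = a -> app A' B' B = b ->
  bijective (app A B : fgroup 2 -> fgroup 2).
Proof.
move=> e1 e2 e3 e4; exists (app A' B' : fgroup 2 -> fgroup 2) => g.
  by rewrite app_app e3 e4 app_ab.
by rewrite app_app e1 e2 app_ab.
Qed.

Lemma inverse_of_bij (A B A' B' : fgroup 2) : bijective (app A B : fgroup 2 -> fgroup 2) ->
  app A B A' = a -> app A B B' = b -> app A' B' A = a /\ app A' B' B = b.
Proof.
move=> /bij_inj inj e1 e2; split; apply: inj.
  by rewrite app_app e1 e2 app_ab app_a.
by rewrite app_app e1 e2 app_ab app_b.
Qed.

Lemma local_rep_inv (A B C D A' B' C' D' : fgroup 2) : local_rep A B C D ->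
  app A B A' = a -> app A B B' = b -> app C D C' = a -> app C D D' = b ->
  local_rep A' B' C' D'.
Proof.
move=> [bijAB bijCD braid] e1 e2 e3 e4.
have [e1' e2'] := inverse_of_bij bijAB e1 e2; have [e3' e4'] := inverse_of_bij bijCD e3 e4.
split; [exact: (bij_of_inverse e1' e2') | exact: (bij_of_inverse e3' e4') | move=> G x y z].
have K1 : cancel (@act1 A B G) (@act1 A' B' G).
  by move=> [[u v] w]; rewrite /act1 /= -!app_app e1 e2 app_a app_b.
have K1' : cancel (@act1 A' B' G) (@act1 A B G).
  by move=> [[u v] w]; rewrite /act1 /= -!app_app e1' e2' app_a app_b.
have K2 : cancel (@act2 C D G) (@act2 C' D' G).
  by move=> [[u v] w]; rewrite /act2 /= -!app_app e3 e4 app_a app_b.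
have K2' : cancel (@act2 C' D' G) (@act2 C D G).
  by move=> [[u v] w]; rewrite /act2 /= -!app_app e3' e4' app_a app_b.
apply/braid_eqsE; apply: (can_inj K1); apply: (can_inj K2); apply: (can_inj K1).
have braidE t : act1 A B (act2 C D (act1 A B t)) = act2 C D (act1 A B (act2 C D t)) :> G * G * G.
  by case: t => -[u v] w; apply/braid_eqsE.
by rewrite [RHS]braidE !(K1', K2').
Qed.

Definition sw (g : fgroup 2) : fgroup 2 := app b a g.
(* Reading a word backwards is inverting its letters and then the element. *)
Definition rv (g : fgroup 2) : fgroup 2 := (app a^-1 b^-1 g)^-1.

Lemma app_sw (G : groupType) (x y : G) g : app x y (sw g) = app y x g.
Proof. by rewrite app_app app_a app_b. Qed.

Lemma app_rv (G : groupType) (x y : G) g : app x y (rv g) = (app x^-1 y^-1 g)^-1.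
Proof. by rewrite appV app_app !appV app_a app_b. Qed.

Lemma swK : involutive sw.
Proof. by move=> g; rewrite /sw app_sw app_ab. Qed.

Lemma rvK : involutive rv.
Proof. by move=> g; rewrite /rv app_rv !invgK app_ab. Qed.

Lemma swM g h : sw (g * h) = sw g * sw h. Proof. exact: appM. Qed.
Lemma sw_zpow g m : sw (zpow g m) = zpow (sw g) m. Proof. exact: app_zpow. Qed.
Lemma sw_a : sw a = b. Proof. exact: app_a. Qed.
Lemma sw_b : sw b = a. Proof. exact: app_b. Qed.

Lemma rvM g h : rv (g * h) = rv h * rv g. Proof. by rewrite /rv appM invgM. Qed.
Lemma rv_a : rv a = a. Proof. by rewrite /rv app_a invgK. Qed.
Lemma rv_b : rv b = b. Proof. by rewrite /rv app_b invgK. Qed.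
Lemma rv_zpow g m : rv (zpow g m) = zpow (rv g) m.
Proof. by rewrite /rv app_zpow -!zpowN1 -!zpowM mulrC. Qed.

Lemma word_sw g : sw g = swapw g :> word 2.
Proof.
pose e (i : 'I_2) := if i == ga then gb else ga.
have inj_e : injective e by move=> i j; case: (ord2P i) => ->; case: (ord2P j) => ->.
have -> : swapw g = relabel e g by [].
rewrite -[RHS]reduce_id ?reduced_relabel ?fgwordP // -[RHS]/(fgword (cls _)); congr fgword.
rewrite -ev_gen ev_relabel; apply: eq_ev => i.
by rewrite /fn2 /e /=; case: ifP.
Qed.

Lemma word_rv g : rv g = rev g :> word 2.
Proof.
rewrite -[RHS]reduce_id ?reduced_rev ?fgwordP // -[RHS]/(fgword (cls _)); congr fgword.
rewrite -[RHS]ev_gen /rv /app; elim: (fgword g) => [|[i s] w IHw]; first by rewrite invg1.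
rewrite rev_cons -cats1 ev_cat -IHw ev_cons invgM /=; congr (_ * _).
by rewrite mulg1 /evl /= /fn2; case: (ord2P i) => -> /=; case: s; rewrite ?invgK.
Qed.

Lemma sym_swap_of A B C D : sym_swap (quad_of A B C D) = quad_of (sw D) (sw C) (sw B) (sw A).
Proof. by rewrite /quad_of !word_sw. Qed.

Lemma sym_back_of A B C D : sym_back (quad_of A B C D) = quad_of (rv A) (rv B) (rv C) (rv D).
Proof. by rewrite /quad_of !word_rv. Qed.

Lemma quad_of_surj A B C D : reduced A -> reduced B -> reduced C -> reduced D ->
  (A, B, C, D) = quad_of (cls A) (cls B) (cls C) (cls D).
Proof. by move=> *; rewrite /quad_of !clsK. Qed.

Lemma sym_inv_of A B C D A' B' C' D' :
  sym_inv (quad_of A B C D) (quad_of A' B' C' D') <->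
  [/\ bijective (app A B : fgroup 2 -> fgroup 2), bijective (app C D : fgroup 2 -> fgroup 2),
      app A B A' = a /\ app A B B' = b & app C D C' = a /\ app C D D' = b].
Proof.
have substE (P Q g h : fgroup 2) : subst (fun2 P Q) g = h <-> app P Q g = h.
  rewrite app_subst; split=> [->|<-]; first exact: fgwordK.
  by rewrite clsK // reduced_subst.
rewrite /sym_inv /= !is_aut_app.
split=> [[h1 [h2 [_ [e1 [e2 [e3 e4]]]]]]|[h1 h2 [e1 e2] [e3 e4]]].
  split=> //; split; [exact: (substE A B A' a).1 | exact: (substE A B B' b).1 |
                      exact: (substE C D C' a).1 | exact: (substE C D D' b).1].
split=> //; split=> //; split; first by rewrite !fgwordP.
by split; [exact: (substE A B A' a).2 | split; [exact: (substE A B B' b).2 |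
   split; [exact: (substE C D C' a).2 | exact: (substE C D D' b).2]]].
Qed.

Lemma app_sw_sw (A B g : fgroup 2) : app (sw B) (sw A) g = sw (app A B (sw g)) :> fgroup 2.
Proof. by rewrite /sw [in RHS]app_app -/(sw A) -/(sw B) -/(sw g) app_sw. Qed.

Lemma app_rv_rv (A B g : fgroup 2) : app (rv A) (rv B) g = rv (app A B (rv g)) :> fgroup 2.
Proof. by rewrite [rv (app _ _ _)]/rv app_app app_rv invgK. Qed.

(** Conjugation by x1 <-> x3 interchanges the roles of s1 and s2: the relation is read at (z, y,
    x). *)
Lemma local_rep_sw A B C D : local_rep A B C D -> local_rep (sw D) (sw C) (sw B) (sw A).
Proof.
have bij P Q : bijective (app P Q : fgroup 2 -> fgroup 2) ->
    bijective (app (sw Q) (sw P) : fgroup 2 -> fgroup 2).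
  move=> bijPQ; apply: eq_bij (fsym (app_sw_sw P Q)).
  by apply: bij_comp (inv_bij swK) (bij_comp bijPQ (inv_bij swK)).
case=> bijAB bijCD braid; split; try exact: bij.
by move=> G x y z; have [E1 E2 E3] := braid G z y x; split; rewrite !app_sw.
Qed.

(** Conjugation by the automorphism inverting all generators: the relation is read at the
    inverses. *)
Lemma local_rep_rv A B C D : local_rep A B C D -> local_rep (rv A) (rv B) (rv C) (rv D).
Proof.
have bij P Q : bijective (app P Q : fgroup 2 -> fgroup 2) ->
    bijective (app (rv P) (rv Q) : fgroup 2 -> fgroup 2).
  move=> bijPQ; apply: eq_bij (fsym (app_rv_rv P Q)).
  by apply: bij_comp (inv_bij rvK) (bij_comp bijPQ (inv_bij rvK)).
case=> bijAB bijCD braid; split; try exact: bij.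
move=> G x y z; have [E1 E2 E3] := braid G x^-1 y^-1 z^-1.
by split; rewrite !app_rv !invgK ?E1 ?E2 ?E3.
Qed.

Definition reachable (A B C D : fgroup 2) : Prop :=
  exists L, listed L /\ up_to_sym L (quad_of A B C D).

Lemma reachable_listed A B C D : listed (quad_of A B C D) -> reachable A B C D.
Proof. by move=> listedL; exists (quad_of A B C D); split=> //; apply: rt_refl. Qed.

Lemma reachable_sw A B C D : reachable A B C D -> reachable (sw D) (sw C) (sw B) (sw A).
Proof.
case=> L [listedL symL]; exists L; split=> //; apply: rt_trans symL _; apply: rt_step.
by left; rewrite sym_swap_of.
Qed.

Lemma reachable_rv A B C D : reachable A B C D -> reachable (rv A) (rv B) (rv C) (rv D).
Proof.
case=> L [listedL symL]; exists L; split=> //; apply: rt_trans symL _; apply: rt_step.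
by right; left; rewrite sym_back_of.
Qed.

Lemma reachable_inv (A B C D A' B' C' D' : fgroup 2) : reachable A B C D ->
  [/\ app A B A' = a, app A B B' = b, app A' B' A = a & app A' B' B = b] ->
  [/\ app C D C' = a, app C D D' = b, app C' D' C = a & app C' D' D = b] ->
  reachable A' B' C' D'.
Proof.
case=> L [listedL symL] [e1 e2 e3 e4] [e5 e6 e7 e8]; exists L; split=> //.
apply: rt_trans symL _; apply: rt_step; right; right; apply/sym_inv_of.
by split=> //; [apply: bij_of_inverse e1 e2 e3 e4 | apply: bij_of_inverse e5 e6 e7 e8].
Qed.

Lemma reachable_swE A B C D : reachable (sw D) (sw C) (sw B) (sw A) -> reachable A B C D.
Proof. by move/reachable_sw; rewrite !swK. Qed.

Lemma local_rep_sym_step q q' : sym_step q q' -> 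
  (exists A B C D, q = quad_of A B C D /\ local_rep A B C D) ->
  exists A B C D, q' = quad_of A B C D /\ local_rep A B C D.
Proof.
move=> step [A [B [C [D [eq_q rep]]]]]; move: step; rewrite {}eq_q => -[->|[->|]].
- by rewrite sym_swap_of; exists (sw D), (sw C), (sw B), (sw A); split=> //; apply: local_rep_sw.
- by rewrite sym_back_of; exists (rv A), (rv B), (rv C), (rv D); split=> //; apply: local_rep_rv.
case: q' => -[[A' B'] C'] D' syminv.
have [red_A' red_B' red_C' red_D'] : [/\ reduced A', reduced B', reduced C' & reduced D'].
  by case: syminv => ? [? []].
have eq_q' := quad_of_surj red_A' red_B' red_C' red_D'; rewrite eq_q' in syminv *.
exists (cls A'), (cls B'), (cls C'), (cls D'); split=> //.
move/sym_inv_of: syminv => [_ _ [e1 e2] [e3 e4]].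
exact: (local_rep_inv rep e1 e2 e3 e4).
Qed.

Lemma local_rep_up_to_sym q q' : up_to_sym q q' ->
  (exists A B C D, q = quad_of A B C D /\ local_rep A B C D) ->
  exists A B C D, q' = quad_of A B C D /\ local_rep A B C D.
Proof.
elim=> [{}q {}q'|//|q1 q2 q3 _ IH1 _ IH2 /IH1/IH2//].
exact: local_rep_sym_step.
Qed.

(** * The listed families *)

Section ZpowRewriting.
Variable G : groupType.
Implicit Types (x y : G) (e i : int).
Local Open Scope ring_scope.

Lemma zpowDA x i j y : (zpow x i * (zpow x j * y) = zpow x (i + j) * y)%g.
Proof. by rewrite mulgA zpowD. Qed.

Lemma zpowNK x i y : (zpow x (- i) * (zpow x i * y) = y)%g.
Proof. by rewrite zpowDA addNr mul1g. Qed.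

Lemma zpowKN x i y : (zpow x i * (zpow x (- i) * y) = y)%g.
Proof. by rewrite zpowDA subrr mul1g. Qed.

Lemma zpow_conj x y i m :
  (zpow (zpow x i * y * zpow x (- i)) m = zpow x i * zpow y m * zpow x (- i))%g.
Proof. by rewrite zpowN zpowJ. Qed.

Lemma zpow_sgn x e i : e * e = 1 -> zpow (zpow x e) (e * i) = zpow x i.
Proof. by move=> ee; rewrite -zpowM mulrA ee mul1r. Qed.

Lemma zpow_sgnN x e i : e * e = 1 -> zpow (zpow x e) (- (e * i)) = zpow x (- i).
Proof. by rewrite -mulrN; apply: zpow_sgn. Qed.

Lemma zpow_sgn1 x e : e * e = 1 -> zpow (zpow x e) e = x.
Proof. by move=> ee; rewrite -zpowM ee. Qed.
End ZpowRewriting.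

Lemma sgnP (e : int) : (e * e = 1)%R -> e = 1%R \/ e = (-1)%R.
Proof. by move=> ee; nia. Qed.

Definition cj (i e : int) : fgroup 2 := zpow a i * zpow b e * zpow a (- i)%R.

Lemma app_cj (G : groupType) (x y : G) i e :
  app x y (cj i e) = zpow x i * zpow y e * zpow x (- i)%R.
Proof. by rewrite /cj !appM !app_zpow app_a app_b. Qed.

(** For tau: a -> a^i b^e a^-i, b -> a^e, the second image gives tau^-1(a) = b^e; inserting this
    into the first gives tau^-1(b) = [B']. *)
Lemma cj_inverse (i e : int) : (e * e = 1)%R ->
  let B' := zpow b (- (e * i))%R * zpow a e * zpow b (e * i)%R in
  [/\ app (cj i e) (zpow a e) (zpow b e) = a, app (cj i e) (zpow a e) B' = b,
      app (zpow b e) B' (cj i e) = a & app (zpow b e) B' (zpow a e) = b].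
Proof.
move=> ee /=; set B' := _ * _.
have app_B : app (cj i e) (zpow a e) B' = b.
  rewrite /B' !appM !app_zpow app_a app_b /cj zpow_conj -mulrN !zpow_sgn // zpow_sgn1 //.
  by rewrite -!mulgA zpowNK -zpowD addNr mulg1.
have B'e : app (zpow b e) B' (cj i e) = a.
  rewrite app_cj /B' -{2}[(e * i)%R]opprK zpow_conj zpow_sgn1 // opprK.
  by rewrite -!zpowM mulrN -!mulgA zpowKN -zpowD subrr mulg1.
by split; rewrite ?app_zpow ?app_a ?app_b ?zpow_sgn1.
Qed.

Lemma local_rep_A (i e e' : int) : (e * e = 1)%R -> (e' * e' = 1)%R ->
  local_rep (cj i e) (zpow a e) (cj (e * i)%R e') (zpow a e').
Proof.
move=> ee ee'; split.
- by case: (cj_inverse i ee) => H1 H2 H3 H4; apply: bij_of_inverse H1 H2 H3 H4.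
- by case: (cj_inverse (e * i) ee') => H1 H2 H3 H4; apply: bij_of_inverse H1 H2 H3 H4.
move=> G x y z; split; rewrite ?app_zpow ?app_a ?app_cj.
- rewrite zpow_sgn // zpow_sgnN // !zpow_conj -!zpowM -!mulgA !zpowNK.
  by rewrite mulrN.
- by rewrite zpow_sgn // zpow_sgnN // zpow_conj !zpow_sgn1.
by rewrite ?app_zpow ?app_a.
Qed.

Lemma reduced_cons_nseq (l m : letter 2) r : l.1 != m.1 -> reduced (l :: nseq r m).
Proof.
move=> neq; have := reduced_nseq r m; case: r => //= r ->; rewrite andbT.
by rewrite /cancels (negPf neq).
Qed.

Lemma word_cj (r : nat) (s : bool) :
  cj r (if s then -1 else 1)%R = apow r ++ (gb, s) :: apowi r :> word 2.
Proof.
rewrite -[RHS]reduce_id.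
  rewrite -[RHS]/(fgword (cls _)); congr fgword.
  rewrite -[_ :: apowi r]cat1s !cls_cat gen_nseq gen_nseqV mulgA /cj; congr (_ * _ * _).
  by case: s; apply/val_inj.
apply: (@reduced_overlap _ (apow r) [:: (gb, s)]) => //; last exact: reduced_cons_nseq.
by rewrite -reduced_rev rev_cat rev_nseq; apply: reduced_cons_nseq.
Qed.

Lemma rv_cj i e : rv (cj i e) = cj (- i)%R e.
Proof. by rewrite /cj !rvM !rv_zpow rv_a rv_b opprK mulgA. Qed.

(** Reading backwards changes the sign of [i]. Three of the four sign patterns are listed; e = -1,
    e' = 1 arises from e = 1, e' = -1 by inversion followed by swap. *)
Lemma reachable_A (i e e' : int) : (e * e = 1)%R -> (e' * e' = 1)%R ->
  reachable (cj i e) (zpow a e) (cj (e * i)%R e') (zpow a e').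
Proof.
move=> ee ee'; suff pos (r : nat) : reachable (cj r e) (zpow a e) (cj (e * r)%R e') (zpow a e').
  case: (intP i) => [|r|r]; [exact: (pos 0) | exact: (pos r.+1) |].
  have := reachable_rv (pos r.+1); rewrite !rv_cj !rv_zpow rv_a.
  by rewrite mulrN.
have wc s := word_cj r s.
have := sgnP ee; have := sgnP ee'; move=> [->|->] [->|->].
- apply: reachable_listed; right; right; left; exists r; rewrite mul1r.
  by rewrite /quad_of (wc false).
- have inv1 := cj_inverse r (erefl : 1 * 1 = 1 :> int)%R.
  have invN := cj_inverse r (erefl : (-1) * (-1) = 1 :> int)%R.
  have A2 : reachable (cj r 1) (zpow a 1) (cj r (-1)) (zpow a (-1)).
    apply: reachable_listed; right; right; right; left; exists r.
    by rewrite /quad_of (wc false) (wc true).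
  have /reachable_sw := reachable_inv A2 inv1 invN; rewrite !swM !sw_zpow sw_a sw_b.
  by rewrite /cj mul1r !mulN1r !opprK.
- apply: reachable_listed; right; right; right; left; exists r; rewrite mul1r.
  by rewrite /quad_of (wc false) (wc true).
apply: reachable_listed; right; right; right; right; left; exists r; rewrite mulN1r.
rewrite /quad_of (wc true) -rv_cj word_rv (wc true).
by rewrite rev_cat rev_cons !rev_nseq cat_rcons.
Qed.

(** Listed for e = -1; inversion changes both signs. *)
Lemma reachable_B (e e' : int) : (e * e = 1)%R -> (e' * e' = 1)%R ->
  reachable (zpow b e) (zpow a (- e)%R) (zpow b e') (zpow a (- e')%R).
Proof.
move=> ee ee'.
have inverse (f : int) : (f * f = 1)%R ->
    [/\ app (zpow b f) (zpow a (- f)%R) (zpow b (- f)%R) = a,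
        app (zpow b f) (zpow a (- f)%R) (zpow a f) = b,
        app (zpow b (- f)%R) (zpow a f) (zpow b f) = a &
        app (zpow b (- f)%R) (zpow a f) (zpow a (- f)%R) = b].
  by move=> ff; split; rewrite app_zpow ?app_a ?app_b -zpowM ?mulrNN ff.
have listedN f : (f * f = 1)%R -> reachable (zpow b (-1)) (zpow a 1) (zpow b f) (zpow a (- f)%R).
  by case/sgnP=> ->; apply: reachable_listed; [do 6 right; left | do 5 right; left].
case: (sgnP ee) => ->; last by rewrite opprK; apply: listedN.
have ee'N : (- e' * - e' = 1)%R by rewrite mulrNN.
have := reachable_inv (listedN _ ee'N) (inverse (-1)%R erefl) (inverse _ ee'N).
by rewrite !opprK.
Qed.

(** For [e] a sign, [parab1] and [parab2] have the homology matrix with rows (2, e) and (-e, 0), of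
    trace 2 and determinant 1. *)
Definition parab1 (i e : int) : fgroup 2 := zpow a i * zpow b e * zpow a (2 - i)%R.
Definition parab2 (k e : int) : fgroup 2 := zpow b k * zpow a (- e)%R * zpow b (- k)%R.

Lemma rv_parab1 i e : rv (parab1 i e) = parab1 (2 - i) e.
Proof. by rewrite /parab1 !rvM !rv_zpow rv_a rv_b mulgA subKr. Qed.

Lemma rv_parab2 k e : rv (parab2 k e) = parab2 (- k) e.
Proof. by rewrite /parab2 !rvM !rv_zpow rv_a rv_b mulgA opprK. Qed.

Lemma reachable_C (e e' : int) : (e * e = 1)%R -> (e' * e' = 1)%R ->
  reachable (parab1 1 e) (parab2 0 e) (parab1 1 e') (parab2 0 e').
Proof.
move=> /sgnP[->|->] /sgnP[->|->].
- by apply: reachable_listed; do 9 right; left.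
- have C2 : reachable (parab1 1 (-1)) (parab2 0 (-1)) (parab1 1 1) (parab2 0 1).
    by apply: reachable_listed; do 8 right; left.
  apply: (reachable_inv (reachable_sw C2)); split; apply/eqP; vm_compute; reflexivity.
- by apply: reachable_listed; do 8 right; left.
by apply: reachable_listed; do 7 right; left.
Qed.

(** The listed words of type D have the diagonal entries 0 and 2 in the other order; they come into
    this class by swap for e = 1 and by inversion for e = -1. The constant [c] is the exponent that
    [parabolic_AC] forces at i = 2. *)
Lemma reachable_D (e e' : int) : (e * e = 1)%R -> (e' * e' = 1)%R ->
  let c := (if e == 1 then 2 else 0)%R in
  reachable (parab1 2 e) (parab2 (- e) e) (parab1 c e') (parab2 (- (e * e')) e').
Proof.
pose D1 := (cls [:: lA; lB; la], cls [:: lb; lb; la]).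
pose D2 := (cls [:: la; lb; lA], cls [:: lb; lb; lA]).
pose D4 := (cls [:: lA; lb; la], cls [:: lA; lb; lb]).
have R1 : reachable D1.1 D1.2 D1.1 D1.2 by apply: reachable_listed; do 10 right; left.
have R2 : reachable D2.1 D2.2 D1.1 D1.2 by apply: reachable_listed; do 11 right; left.
have R4 : reachable D2.1 D2.2 D4.1 D4.2 by apply: reachable_listed; do 13 right.
move=> /sgnP[->|->] /sgnP[->|->] /=.
- by congr (reachable _ _ _ _): (reachable_sw R1); apply/eqP; vm_compute.
- by congr (reachable _ _ _ _): (reachable_sw R2); apply/eqP; vm_compute.
- by apply: (reachable_inv R2); split; apply/eqP; vm_compute.
by apply: (reachable_inv R4); split; apply/eqP; vm_compute.
Qed.

Lemma reachable_T (d : int) : (d * d = 1)%R -> reachable a (zpow b d) (zpow a d) b.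
Proof. by move=> /sgnP[->|->]; apply: reachable_listed; [left | right; left]. Qed.

Lemma is_aut_inverse n (f f' : 'I_n -> word n) :
  (forall i, subst f (f' i) = [:: (i, false)]) -> (forall i, subst f' (f i) = [:: (i, false)]) ->
  is_aut f.
Proof.
move=> ff' f'f.
have comp (h k : 'I_n -> word n) (g : fgroup n) : (forall i, subst h (k i) = [:: (i, false)]) ->
    ev (fun i => cls (h i)) (ev (fun i => cls (k i)) g) = g.
  move=> hk; rewrite ev_comp -[RHS]ev_genK; apply: eq_ev => i.
  by rewrite ev_cls -cls_subst hk.
by apply/is_autP; exists (fun g : fgroup n => ev (fun i => cls (f' i)) g) => g; apply: comp.
Qed.

Lemma quad_exists (q : quad) : local_braid_rep q ->
  reduced q.1.1.1 -> reduced q.1.1.2 -> reduced q.1.2 -> reduced q.2 ->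
  exists A B C D, q = quad_of A B C D /\ local_rep A B C D.
Proof.
case: q => -[[A B] C] D rep rA rB rC rD; exists (cls A), (cls B), (cls C), (cls D).
by rewrite (quad_of_surj rA rB rC rD) in rep *; split=> //; apply/local_repP.
Qed.

Lemma ord2_ind (P : 'I_2 -> Prop) : P ga -> P gb -> forall i, P i.
Proof. by move=> Pa Pb i; case: (ord2P i) => ->. Qed.

Lemma ord3_ind (P : 'I_3 -> Prop) : P x1 -> P x2 -> P x3 -> forall i, P i.
Proof. by move=> P1 P2 P3 i; case: (ord3P i) => ->. Qed.

(** The arguments are the images of the generators under the two inverse automorphisms. *)
Ltac rep_by_computation A' B' C' D' := apply: quad_exists => //; split;
  [apply: (is_aut_inverse (f' := fun2 A' B')); elim/ord2_ind; apply/eqP; vm_compute; reflexivity |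
  split; [apply: (is_aut_inverse (f' := fun2 C' D')); elim/ord2_ind; apply/eqP; vm_compute; reflexivity |
  elim/ord3_ind; apply/eqP; vm_compute; reflexivity]].

Lemma listed_local_rep L : listed L -> exists A B C D, L = quad_of A B C D /\ local_rep A B C D.
Proof.
have wc r s := word_cj r s.
move=> [->|[->|[[r ->]|[[r ->]|[[r ->]|[->|[->|[->|[->|[->|[->|[->|[->|->]]]]]]]]]]]]].
- by rep_by_computation [:: la] [:: lb] [:: la] [:: lb].
- by rep_by_computation [:: la] [:: lB] [:: lA] [:: lb].
- exists (cj r 1), (zpow a 1), (cj (1 * r%:Z)%R 1), (zpow a 1); split; last exact: local_rep_A.
  by rewrite mul1r /quad_of (wc r false).
- exists (cj r 1), (zpow a 1), (cj (1 * r%:Z)%R (-1)), (zpow a (-1)); split; last exact: local_rep_A.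
  by rewrite mul1r /quad_of (wc r false) (wc r true).
- exists (cj r (-1)), (zpow a (-1)), (cj (-1 * r%:Z)%R (-1)), (zpow a (-1)); split.
    rewrite mulN1r /quad_of -rv_cj word_rv (wc r true).
    by rewrite rev_cat rev_cons !rev_nseq cat_rcons.
  exact: local_rep_A.
- by rep_by_computation [:: lb] [:: lA] [:: lb] [:: lA].
- by rep_by_computation [:: lb] [:: lA] [:: lB] [:: la].
- by rep_by_computation [:: lb] [:: lb; lA; lb] [:: lb] [:: lb; lA; lb].
- by rep_by_computation [:: lb] [:: lb; lA; lb] [:: lB] [:: lb; la; lb].
- by rep_by_computation [:: lB] [:: lb; la; lb] [:: lB] [:: lb; la; lb].
- by rep_by_computation [:: lb; la; la] [:: lb; lA; lB] [:: lb; la; la] [:: lb; lA; lB].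
- by rep_by_computation [:: la; la; lB] [:: lb; la; lB] [:: lb; la; la] [:: lb; lA; lB].
- by rep_by_computation [:: lb; la; la] [:: lb; lA; lB] [:: lB; la; la] [:: lB; la; lb].
by rep_by_computation [:: la; la; lB] [:: lb; la; lB] [:: lB; la; la] [:: lB; la; lb].
Qed.

(** * The action on homology *)

Section AbelianClasses.
Local Open Scope ring_scope.

Lemma ex_app n j (U V : fgroup n) (g : fgroup 2) :
  ex j (app U V g) = ex ga g * ex j U + ex gb g * ex j V.
Proof.
rewrite (additive_ex (d := fun g : fgroup 2 => ex j (app U V g))) => [|x y]; last first.
  by rewrite appM exM.
rewrite big_ord_recl big_ord1 (_ : lift ord0 ord0 = gb) ?app_b ?(app_a U V) //.
exact/val_inj.
Qed.

Lemma app_same_zpow (G : groupType) (t : G) m1 m2 (g : fgroup 2) :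
  app (zpow t m1) (zpow t m2) g = zpow t (m1 * ex ga g + m2 * ex gb g).
Proof.
rewrite -[g]ev_genK ev_gen /app ev_cls; elim: (fgword g) => [|[i s] w IHw].
  by rewrite cls_nil !ex1 !mulr0.
rewrite ev_cons IHw -cat1s cls_cat !exM -evl_gen.
have -> : evl (fn2 (zpow t m1) (zpow t m2)) (i, s) =
          zpow t (m1 * ex ga (evl (@gen 2) (i, s)) + m2 * ex gb (evl (@gen 2) (i, s))).
  by case: (ord2P i) => ->; case: s; rewrite /evl /= ?exV !ex_gen /= /fn2 /= -?zpowN;
     congr zpow; ring.
by rewrite -zpowD; congr zpow; ring.
Qed.

Lemma app_pow_l (G : groupType) (V : G) (g : fgroup 2) : app 1%g V g = zpow V (ex gb g).
Proof. by have := app_same_zpow V 0 1 g; rewrite mul0r add0r mul1r. Qed.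

Lemma app_pow_r (G : groupType) (U : G) (g : fgroup 2) : app U 1%g g = zpow U (ex ga g).
Proof. by have := app_same_zpow U 1 0 g; rewrite mul0r addr0 mul1r. Qed.

(** With rows (p, q), (r, s) for tau and (p', q'), (r', s') for kappa, this is the braid relation
    between the 3 by 3 matrices of s1 and s2, entry by entry. *)
Lemma abelian_eqs (A B C D : fgroup 2) : local_rep A B C D ->
  let: (p, q, r, s) := (ex ga A, ex gb A, ex ga B, ex gb B) in
  let: (p', q', r', s') := (ex ga C, ex gb C, ex ga D, ex gb D) in
  [/\ p * (1 - p) = q * r * p', q * (p + p' * s - p') = 0, r * (p + p' * s - p') = 0 &
      q * r - q' * r' = p' * s * (p' - s)] /\
  [/\ s' * (1 - s') = q' * r' * s, q' * (p' * s + s' - s) = 0 & r' * (p' * s + s' - s) = 0].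
Proof.
move=> [_ _ braid]; have [E1 E2 E3] := braid _ (gen x1) (gen x2) (gen x3).
have get i := (congr1 (ex i) E1, congr1 (ex i) E2, congr1 (ex i) E3).
move: (get x1) (get x2) (get x3); rewrite !ex_app !ex_gen /= => -[[a1 a2] a3] [[b1 b2] b3] [[c1 c2] c3].
by split; split; lia.
Qed.

Lemma mulz_eq1 (u v : int) : u * v = 1 -> u = v /\ (v = 1 \/ v = -1).
Proof.
move=> uv1; have v1 : v = 1 \/ v = -1.
  by move: (congr1 absz uv1); rewrite abszM => /eqP; rewrite muln_eq1 => /andP[_ /eqP]; lia.
by split=> //; case: v1 uv1 => ->; lia.
Qed.

Lemma abelian_det (A B : fgroup 2) : bijective (app A B : fgroup 2 -> fgroup 2) ->
  let d := ex ga A * ex gb B - ex gb A * ex ga B in d * d = 1.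
Proof.
case=> f _ fK /=; have fa := fK a; have fb := fK b.
move: (congr1 (ex ga) fa) (congr1 (ex gb) fa) (congr1 (ex ga) fb) (congr1 (ex gb) fb).
rewrite !ex_app !ex_gen /=.
set u := ex ga (f a); set v := ex gb (f a); set w := ex ga (f b); set x := ex gb (f b).
set p := ex ga A; set q := ex gb A; set r := ex ga B; set s := ex gb B => e1 e2 e3 e4.
have : (u * x - v * w) * (p * s - q * r) = 1.
  have -> : (u * x - v * w) * (p * s - q * r) =
    (u * p + v * r) * (w * q + x * s) - (u * q + v * s) * (w * p + x * r) by ring.
  by rewrite e1 e2 e3 e4.
by case/mulz_eq1 => _ [->|->].
Qed.

(** Each matrix is diagonal or satisfies the linear relation in the second factor of its equations;
    the determinants exclude the mixed cases. If both relations hold and p' is nonzero, then (1 -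
    s)(p' - 1) is a determinant, hence a sign, so p' = 2; likewise s is 0 or 2. The four choices of
    (p', s) are the four remaining classes. *)
Lemma abelian_classes (p q r s p' q' r' s' : int) :
  p * (1 - p) = q * r * p' -> q * (p + p' * s - p') = 0 -> r * (p + p' * s - p') = 0 ->
  q * r - q' * r' = p' * s * (p' - s) ->
  s' * (1 - s') = q' * r' * s -> q' * (p' * s + s' - s) = 0 -> r' * (p' * s + s' - s) = 0 ->
  (p * s - q * r) * (p * s - q * r) = 1 -> (p' * s' - q' * r') * (p' * s' - q' * r') = 1 ->
  [\/ [/\ [/\ q = 0, r = 0, q' = 0 & r' = 0], p = 1, s' = 1, p' = s & s * s = 1],
      [/\ [/\ p = 0, s = 0, p' = 0 & s' = 0], q * r = q' * r' & (q * r) * (q * r) = 1],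
      [/\ p = 2, s = 0, p' = 2, s' = 0 & q * r = -1 /\ q' * r' = -1] |
      [/\ p = 0, s = 2, p' = 0, s' = 2 & q * r = -1 /\ q' * r' = -1] \/
      [/\ p = -2, s = 2, p' = 2, s' = -2 & q * r = -3 /\ q' * r' = -3]].
Proof.
move=> h1 h2 h3 h4 h5 h6 h7 h8 h9.
have split0 (x y k : int) : x * k = 0 -> y * k = 0 -> k = 0 \/ x = 0 /\ y = 0.
  move=> /eqP; rewrite mulf_eq0 => /orP[/eqP->|/eqP->]; last by left.
  by move=> /eqP; rewrite mulf_eq0 => /orP[/eqP->|/eqP->]; [right | left].
have unit1 (x y : int) : (x * y) * (x * y) = 1 -> (x = 1 \/ x = -1) /\ (y = 1 \/ y = -1).
  move=> xy1; split.
    by have [|_] := @mulz_eq1 (y * x * y) x; first by rewrite -xy1; ring.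
  by have [|_] := @mulz_eq1 (x * x * y) y; first by rewrite -xy1; ring.
have diag : q = 0 -> r = 0 -> p = 1 /\ (s = 1 \/ s = -1).
  move=> q0 r0; have ps1 : (p * s) * (p * s) = 1 by rewrite -h8 q0 mul0r subr0.
  by have [p1 s1] := unit1 _ _ ps1; split=> //; move: h1; rewrite q0; lia.
have diag' : q' = 0 -> r' = 0 -> s' = 1 /\ (p' = 1 \/ p' = -1).
  move=> q0 r0; have ps1 : (p' * s') * (p' * s') = 1 by rewrite -h9 q0 mul0r subr0.
  by have [p1 s1] := unit1 _ _ ps1; split=> //; move: h5; rewrite q0; lia.
case: (split0 _ _ _ h2 h3) (split0 _ _ _ h6 h7) => [k0|[q0 r0]] [k'0|[q'0 r'0]].
- have ep : p = p' * (1 - s) by lia.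
  have es' : s' = s * (1 - p') by lia.
  have f1 : p' * ((1 - s) * (p' - 1) - (p * s - q * r)) = 0.
    have -> : p' * ((1 - s) * (p' - 1) - (p * s - q * r)) =
      p' * (1 - s) * (p' - 1) - p' * p * s + q * r * p' by ring.
    by rewrite -h1 ep; ring.
  have f2 : s * ((1 - p') * (s - 1) - (p' * s' - q' * r')) = 0.
    have -> : s * ((1 - p') * (s - 1) - (p' * s' - q' * r')) =
      s * (1 - p') * (s - 1) - p' * s' * s + q' * r' * s by ring.
    by rewrite -h5 es'; ring.
  have d1 : p' <> 0 -> p' = 2.
    move/eqP: f1; rewrite mulf_eq0 => /orP[/eqP//|]; rewrite subr_eq0 => /eqP f1 nz.
    by move: h8; rewrite -f1 => /unit1; lia.
  have d2 : s <> 0 -> s = 2.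
    move/eqP: f2; rewrite mulf_eq0 => /orP[/eqP//|]; rewrite subr_eq0 => /eqP f2 nz.
    by move: h9; rewrite -f2 => /unit1; lia.
  have [p'0|/eqP/d1 ep'] := eqVneq p' 0; have [s0|/eqP/d2 es] := eqVneq s 0.
  + by subst; constructor 2; split; [split; lia | lia | lia].
  + by subst; constructor 4; left; split; lia.
  + by subst; constructor 3; split; lia.
  by subst; constructor 4; right; split; lia.
- have ep : p = p' * (1 - s) by lia.
  have [s'1 p'1] := diag' q'0 r'0.
  have qr : q * r = p' * s * (p' - s) by rewrite -h4 q'0 mul0r subr0.
  by move: h8; rewrite qr ep; case: p'1 => ->; lia.
- have es' : s' = s * (1 - p') by lia.
  have [p1 s1] := diag q0 r0.
  have qr : q' * r' = - (p' * s * (p' - s)) by rewrite -h4 q0; ring.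
  by move: h9; rewrite qr es'; case: s1 => ->; lia.
have [p1 s1] := diag q0 r0; have [s'1 p'1] := diag' q'0 r'0.
constructor 1; subst q r q' r' p s'.
by split=> //; case: s1 h4 => ->; case: p'1 => ->; lia.
Qed.
End AbelianClasses.

(** * Determination of the words in each homology class *)

(* [(m1, m2)] vanishes on the homology classes fixed by the first automorphism, so it kills all pieces of
   the fixed element [A(x1, C(x2, x3))]. *)
Lemma fixed_eq (A B C D : fgroup 2) (m1 m2 : int) : local_rep A B C D ->
  (forall x y : int, (x * ex ga A + y * ex ga B = x -> x * ex gb A + y * ex gb B = y ->
     m1 * x + m2 * y = 0)%R) ->
  app (zpow a m1) (app (zpow a m2) b C) A = zpow b (ex gb A * ex gb C)%R.
Proof.
move=> [bijAB _ braid] kill; set W := app (gen x1) (app (gen x2) (gen x3) C) A.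
have gen3 : @gen 3 =1 fn3 (gen x1) (gen x2) (gen x3) by move=> j; case: (ord3P j) => ->.
have fixW : subst (s1f (quad_of A B C D)) W = W.
  apply: cls_inj; rewrite ?reduced_subst ?fgwordP // -!ev_gen !(eq_ev gen3) ev_subst.
  rewrite (eq_ev (ev_s1f _ _ _ _ _ _ _)) -(eq_ev gen3) ev_gen fgwordK.
  rewrite /W [LHS](app_morph _ _ _ (evM _)) (app_morph _ _ _ (evM _)).
  rewrite !ev_cls /= /evl /= !mulg1.
  by have [] := braid _ (gen x1) (gen x2) (gen x3).
have inj (p : fgroup 2) : app A B p = 1 -> p = 1.
  by move=> app1p; apply: (bij_inj bijAB); rewrite app1p.
pose h := fn3 (zpow a m1) (zpow a m2) b.
have killh (p : fgroup 2) : app A B p = p -> ev (h \o e12) p = 1.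
  move=> fix_p; have -> : ev (h \o e12) p = app (zpow a m1) (zpow a m2) p.
    by apply: eq_ev => i; case: (ord2P i) => ->.
  rewrite app_same_zpow kill //; first by move: (congr1 (ex ga) fix_p); rewrite ex_app.
  by move: (congr1 (ex gb) fix_p); rewrite ex_app.
have [e ev_h] := fixed_pieces inj killh (fgwordP W) fixW.
have hW : ev h W = app (zpow a m1) (app (zpow a m2) b C) A.
  by rewrite /W !(app_morph _ _ _ (evM _)) !ev_cls /= /evl /= !mulg1.
(* The exponent left open by [fixed_pieces] is the exponent sum of [b]. *)
rewrite -hW ev_h; congr zpow.
move: (congr1 (ex gb) ev_h); rewrite hW !ex_app !ex_zpow !ex_gen /=; lia.
Qed.

(** For V = C(a^m2, b) and g = A(a^m1, b) the hypothesis reads g(a, V) = b^n, which determines the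
    shape of V; as m2 is a sign, C is recovered from V. *)
Lemma C_shape (A C : fgroup 2) (m1 m2 n : int) : (m2 * m2 = 1)%R -> n != 0%R ->
  app (zpow a m1) (app (zpow a m2) b C) A = zpow b n ->
  exists p r, (p + r = ex ga C)%R /\ C = zpow a p * zpow b (ex gb C) * zpow a r.
Proof.
move=> m22 nz_n; set V := app _ b C => eqA.
have {}eqA : app a V (app (zpow a m1) b A) = zpow b n by rewrite app_app app_zpow app_a app_b.
have [p [m [r [nz_m eV]]]] := app_eq_power_b nz_n eqA.
have eC : C = zpow a (m2 * p)%R * zpow b m * zpow a (m2 * r)%R.
  have -> : C = app (zpow a m2) b V by rewrite /V app_app app_zpow app_a app_b zpow_sgn1 ?app_ab.
  by rewrite eV !appM !app_zpow app_a app_b -!zpowM.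
exists (m2 * p)%R, (m2 * r)%R; split.
  by rewrite eC !exM !ex_zpow !ex_gen /=; ring.
have -> : ex gb C = m by rewrite eC !exM !ex_zpow !ex_gen /=; ring.
exact: eC.
Qed.

(** Once V is known, b^(ex gb C) = a^(-m2 p) V a^(-m2 r) shows that the word [A'] has the same value
    as [A]; substitution of (a^m1, V) is injective. *)
Lemma A_shape (A C : fgroup 2) (m1 m2 : int) p r : (m1 * m1 = 1)%R ->
  ex gb C != 0%R -> C = zpow a p * zpow b (ex gb C) * zpow a r ->
  app (zpow a m1) (app (zpow a m2) b C) A = zpow b (ex gb A * ex gb C)%R ->
  A = zpow (zpow a (- (m1 * m2 * p))%R * b * zpow a (- (m1 * m2 * r))%R) (ex gb A).
Proof.
move=> m11 nz_C eC; pose A' := zpow (zpow a (- (m1 * m2 * p))%R * b * zpow a (- (m1 * m2 * r))%R) (ex gb A); set V := app _ b C => eqA.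
have eV : V = zpow a (m2 * p)%R * zpow b (ex gb C) * zpow a (m2 * r)%R.
  by rewrite /V {1}eC !appM !app_zpow app_a app_b -!zpowM.
have invol (X : fgroup 2) : app (zpow a m1) b (app (zpow a m1) b X) = X.
  by rewrite app_app app_zpow app_a app_b zpow_sgn1 ?app_ab.
have step (X : fgroup 2) : app a V (app (zpow a m1) b X) = app (zpow a m1) V X.
  by rewrite app_app app_zpow app_a app_b.
rewrite -[RHS]/A'; suff: app (zpow a m1) V A = app (zpow a m1) V A'.
  rewrite -!step eV => /(app_shape_inj nz_C) eqAA'.
  by move: (congr1 (fun X : fgroup 2 => app (zpow a m1) b X) eqAA'); rewrite !invol.
rewrite eqA [in LHS]mulrC [in LHS]zpowM /A' app_zpow !appM !app_zpow app_a app_b eV; congr (zpow _ _).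
rewrite -!zpowM.
have -> : (m1 * - (m1 * m2 * p) = - (m2 * p))%R.
  by rewrite mulrN !mulrA m11 mul1r.
have -> : (m1 * - (m1 * m2 * r) = - (m2 * r))%R.
  by rewrite mulrN !mulrA m11 mul1r.
by rewrite -!mulgA zpowNK -zpowD subrr mulg1.
Qed.

(** * Zero diagonal and determinant 1: rotations *)

Lemma ex_sw (g : fgroup 2) : (ex ga (sw g) = ex gb g) * (ex gb (sw g) = ex ga g).
Proof. by rewrite /sw !ex_app !ex_gen /= !mulr0 !mulr1 add0r addr0. Qed.

(** A rotation fixes no nonzero vector, so every (m1, m2) is admissible: (1, 0) turns C into a power
    of [b] and isolates A, while (0, 1) turns A into a power and isolates C. *)
Lemma rotation_AC (A B C D : fgroup 2) : local_rep A B C D ->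
  ex ga A = 0%R -> ex gb B = 0%R -> ex ga C = 0%R -> (ex gb C * ex gb C = 1)%R ->
  (ex gb A * ex ga B = -1)%R -> A = zpow b (ex gb A) /\ C = zpow b (ex gb C).
Proof.
move=> rep A0 B0 C0 CC AB.
have AA : (ex gb A * ex gb A = 1)%R.
  by have [|_ [->|->]] := @mulz_eq1 (- ex ga B)%R (ex gb A); first by rewrite mulNr mulrC AB.
have no_fix (m1 m2 x y : int) : (x * ex ga A + y * ex ga B = x -> x * ex gb A + y * ex gb B = y ->
     m1 * x + m2 * y = 0)%R.
  rewrite A0 B0 !mulr0 add0r addr0 => e1 e2.
  have y0 : y = 0%R.
    have : (y = - y)%R by rewrite -{1}e2 -{1}e1 -mulrA [(_ * ex gb A)%R]mulrC AB mulrN1.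
    lia.
  by move: e1; rewrite y0 mul0r => <-; rewrite !mulr0.
split.
  have := fixed_eq (m1 := 1%R) (m2 := 0%R) rep (no_fix _ _).
  rewrite zpow0 zpow1 app_pow_l => eqA.
  have invol : app a (zpow b (ex gb C)) (app a (zpow b (ex gb C)) A) = A.
    by rewrite app_app app_zpow app_a app_b zpow_sgn1 // app_ab.
  apply: etrans (esym invol) _; rewrite eqA app_zpow app_b -zpowM; congr zpow.
  by rewrite mulrCA CC mulr1.
have := fixed_eq (m1 := 0%R) (m2 := 1%R) rep (no_fix _ _).
rewrite zpow0 zpow1 app_pow_l app_ab => eqC.
rewrite -[LHS](zpow_sgn1 _ AA) eqC -zpowM; congr zpow.
by rewrite mulrAC AA mul1r.
Qed.

Lemma case_rotation (A B C D : fgroup 2) : local_rep A B C D ->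
  ex ga A = 0%R -> ex gb B = 0%R -> ex ga C = 0%R -> ex gb D = 0%R ->
  (ex gb A * ex ga B = -1)%R -> (ex gb C * ex ga D = -1)%R -> reachable A B C D.
Proof.
move=> rep A0 B0 C0 D0 AB CD.
have sgn (x y : int) : (x * y = -1)%R -> [/\ (x * x = 1)%R, (y * y = 1)%R & y = (- x)%R].
  move=> xy; have [|e [e1|e1]] := @mulz_eq1 (- x)%R y; first by rewrite mulNr xy opprK.
    have ex : x = (-1)%R by lia.
    by rewrite ex e1; split; lia.
  have ex : x = 1%R by lia.
  by rewrite ex e1; split; lia.
have [AA BB eB] := sgn _ _ AB; have [CC DD eD] := sgn _ _ CD.
have [eA eC] := rotation_AC rep A0 B0 C0 CC AB.
have := rotation_AC (local_rep_sw rep); rewrite !ex_sw => /(_ D0 C0 B0 BB).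
rewrite [(ex ga D * _)%R]mulrC => /(_ CD)[/(congr1 sw) esD /(congr1 sw) esB].
rewrite !swK !sw_zpow !sw_b in esD esB.
rewrite eA esB eC esD eB eD; exact: reachable_B.
Qed.

(** * Second coefficients; zero diagonal and determinant -1: reflections *)

Local Notation c12 g := (mag g [:: ga; gb]).

Lemma mag_a m w : alternating w -> mag (zpow a m) w =
  if w is [::] then 1%R else if w is [:: j] then if j == ga then m else 0%R else 0%R.
Proof. exact: mag_zpow_gen. Qed.
Lemma mag_b m w : alternating w -> mag (zpow b m) w =
  if w is [::] then 1%R else if w is [:: j] then if j == gb then m else 0%R else 0%R.
Proof. exact: mag_zpow_gen. Qed.

Lemma c12_zpow (g : fgroup 2) m :
  (2 * c12 (zpow g m) = 2 * m * c12 g + m * (m - 1) * ex ga g * ex gb g)%R.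
Proof. exact: mag2_zpow. Qed.

Lemma c12_shuffle (g : fgroup 2) :
  (mag g [:: ga; gb] + mag g [:: gb; ga] = ex ga g * ex gb g)%R.
Proof.
rewrite -[g]ev_genK; elim: (fgword g) => [|[i s] w IHw]; first by rewrite !mag1.
rewrite ev_cons !mag2M !exM.
have -> : evl (@gen 2) (i, s) = zpow (gen i) (if s then -1 else 1)%R.
  by rewrite /evl /=; case: s; rewrite ?zpowN1.
rewrite !mag_zpow_gen // !ex_zpow !ex_gen.
by case: (ord2P i) => -> /=; lia.
Qed.

Lemma commute_powers_c12 (R : fgroup 2) n : n != 0%R ->
  R * zpow a n = zpow a n * R -> R * zpow b n = zpow b n * R ->
  [/\ ex ga R = 0%R, ex gb R = 0%R & c12 R = 0%R].
Proof.
move=> nz_n Ra Rb; have n0 (x : int) : (x * n = 0 -> x = 0)%R by move=> xn0; nia.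
have exb : ex gb R = 0%R.
  move: (congr1 (fun g : fgroup 2 => mag g [:: ga; gb]) Ra).
  by rewrite !mag2M !ex_zpow !ex_gen /= mag_a //= => e; apply: n0; lia.
have exa : ex ga R = 0%R.
  move: (congr1 (fun g : fgroup 2 => mag g [:: ga; gb]) Rb).
  by rewrite !mag2M !ex_zpow !ex_gen /= mag_b //= => e; apply: n0; lia.
split=> //.
(* The coefficients of ab and ba have sum zero, and the coefficient of aba in the first hypothesis
   shows that they are equal. *)
have := c12_shuffle R; rewrite exa mul0r.
move: (congr1 (fun g : fgroup 2 => mag g [:: ga; gb; ga]) Ra).
rewrite !magM /= !mag_a //= => e1 e2.
by apply: n0; lia.
Qed.

(* [P z^n Q = P' z^n Q'] for free [z] forces [P = P'] and [Q = Q']; only second coefficients are needed. *)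
Lemma outer_c12 (P P' Q Q' : fgroup 2) n : n != 0%R ->
  (forall z : fgroup 2, P * zpow z n * Q = P' * zpow z n * Q') ->
  c12 P = c12 P' /\ c12 Q = c12 Q'.
Proof.
move=> nz_n eqPQ; have := eqPQ 1; rewrite zpow1g !mulg1 => PQ.
have [R eP] : exists R, P = P' * R by exists (P'^-1 * P); rewrite mulVKg.
have eQ : Q' = R * Q by apply: (mulgI P'); rewrite -PQ eP mulgA.
have commR (z : fgroup 2) : R * zpow z n = zpow z n * R.
  by have := eqPQ z; rewrite eP eQ !mulgA => /mulIg; rewrite -!mulgA => /mulgI.
have [exa exb cR] := commute_powers_c12 nz_n (commR a) (commR b).
by rewrite eP eQ !mag2M exa exb cR; split; lia.
Qed.

Lemma c12_cj i e : c12 (cj i e) = (i * e)%R.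
Proof. by rewrite /cj !mag2M !mag_a // !mag_b // !exM !ex_zpow !ex_gen /=; ring. Qed.

(** The fixed vectors are the multiples of (1, q) with q = [ex gb A], on which (q, -1) vanishes.
    Exponent sum 0 in [a] turns the shape of C into a conjugate. *)
Lemma reflection_AC (A B C D : fgroup 2) : local_rep A B C D ->
  ex ga A = 0%R -> ex gb B = 0%R -> ex ga C = 0%R -> (ex gb C * ex gb C = 1)%R ->
  (ex gb A * ex ga B = 1)%R ->
  exists i, A = cj i (ex gb A) /\ C = cj (ex gb A * i)%R (ex gb C).
Proof.
move=> rep A0 B0 C0 CC AB; have [eAB A1] := mulz_eq1 AB.
have AA : (ex gb A * ex gb A = 1)%R by rewrite {2}eAB.
have NN : ((-1) * (-1) = 1 :> int)%R by [].
have fixA := fixed_eq (m1 := ex gb A) (m2 := (-1)%R) rep.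
have nzA : (ex gb A != 0)%R by apply/eqP => e; move: AA; rewrite e.
have nzC : (ex gb C != 0)%R by apply/eqP => e; move: CC; rewrite e.
have {}fixA : app (zpow a (ex gb A)) (app (zpow a (-1)) b C) A = zpow b (ex gb A * ex gb C)%R.
  apply: fixA => x y; rewrite A0 B0 -eAB => e1 e2.
  by rewrite -e2; ring.
have [p [r [pr eC]]] := C_shape NN (mulf_neq0 nzA nzC) fixA.
have eA := A_shape AA nzC eC fixA.
have er : r = (- p)%R by lia.
rewrite er in eA eC; exists (ex gb A * p)%R.
rewrite mulrA AA mul1r; split; last exact: eC.
apply: etrans eA _.
have -> : (- (ex gb A * -1 * p) = ex gb A * p)%R by ring.
have -> : (- (ex gb A * -1 * - p) = - (ex gb A * p))%R by ring.
exact: zpow_conj.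
Qed.

Lemma case_reflection (A B C D : fgroup 2) : local_rep A B C D ->
  ex ga A = 0%R -> ex gb B = 0%R -> ex ga C = 0%R -> ex gb D = 0%R ->
  (ex gb A * ex ga B = 1)%R -> (ex gb C * ex ga D = 1)%R -> reachable A B C D.
Proof.
move=> rep A0 B0 C0 D0 AB CD.
have [eAB A1] := mulz_eq1 AB; have [eCD C1] := mulz_eq1 CD.
have AA : (ex gb A * ex gb A = 1)%R by rewrite {2}eAB.
have CC : (ex gb C * ex gb C = 1)%R by rewrite {2}eCD.
have [i [eA eC]] := reflection_AC rep A0 B0 C0 CC AB.
have := reflection_AC (local_rep_sw rep); rewrite !ex_sw -eAB -eCD => /(_ D0 C0 B0 AA CC).
move=> [j [esD esB]].
have eB : B = zpow b (ex gb C * j)%R * zpow a (ex gb A) * zpow b (- (ex gb C * j))%R.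
  by rewrite -[LHS]swK esB /cj !swM !sw_zpow sw_a sw_b.
set e := ex gb A in AA esB eB eA eC *; set e' := ex gb C in CC esD esB eB eC *.
(* [i] describes A and C, [j] describes B and D. The first braid equation with [z] free compares A^i
   B^(ei) with a^i b^(ei); their second coefficients give i j = 0. *)
have ij : (i * j = 0)%R.
  have outer (z : fgroup 2) : (zpow A i * zpow B (e * i)) * zpow z (e * e') *
      (zpow B (- (e * i)) * zpow A (- i)) =
      (zpow a i * zpow b (e * i)) * zpow z (e * e') * (zpow b (- (e * i)) * zpow a (- i)).
    have [_ _ braid] := rep; have [E1 _ _] := braid _ a b z; move: E1.
    rewrite !app_ab eA eC !app_cj -eA -/(cj _ _).
    rewrite !zpow_conj -!zpowM !mulgA [(e' * e)%R]mulrC.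
    exact.
  have nz : (e * e' != 0)%R.
    by apply: mulf_neq0; apply/eqP => e0; [move: AA | move: CC]; rewrite e0.
  have [c12P _] := outer_c12 nz outer; move: c12P.
  have cA := c12_zpow A i; have cB := c12_zpow B (e * i).
  move: cA cB; rewrite !mag2M !ex_zpow !ex_gen A0 B0 /= mag_a // mag_b //.
  have -> : c12 A = (i * e)%R by rewrite eA c12_cj.
  have -> : c12 B = (- (e' * j * e))%R.
    by rewrite eB !mag2M !mag_a // !mag_b // !exM !ex_zpow !ex_gen /=; ring.
  rewrite -eAB -eCD -/e -/e' in A1 C1.
  by case: A1 => ->; case: C1 => ->; lia.
(* j = 0 is the A family as parametrised, i = 0 its swap. *)
have /orP[/eqP i0|/eqP j0] : (i == 0)%R || (j == 0)%R by rewrite -mulf_eq0 ij.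
  apply: reachable_swE; rewrite esD esB eA eC i0 mulr0 /cj !swM !sw_zpow sw_a sw_b.
  rewrite !zpow0 !mul1g !mulg1; exact: reachable_A.
have eD : D = zpow a e' by rewrite -[D]swK esD j0 /cj !swM !sw_zpow sw_b mul1g mulg1.
have {}eB : B = zpow a e by rewrite eB j0 mulr0 mul1g mulg1.
rewrite eA eB eC eD; exact: reachable_A.
Qed.

(** * Trace 2: parabolic matrices *)

Lemma app_conj (G : groupType) (x y g : G) (w : fgroup 2) :
  app (g * x * g^-1) (g * y * g^-1) w = g * app x y w * g^-1.
Proof.
rewrite [RHS](app_morph (phi := fun z => g * z * g^-1)) // => u v.
by rewrite !mulgA mulgVK.
Qed.

(* After conjugation the basis becomes [(A', a^e)], to which the ping-pong lemma applies. *)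
Lemma basis_conj (A : fgroup 2) (k e : int) : (e * e = 1)%R ->
  bijective (app A (zpow b k * zpow a e * zpow b (- k)%R) : fgroup 2 -> fgroup 2) ->
  exists p m r, A * zpow b k = zpow b k * (zpow a p * zpow b m * zpow a r).
Proof.
move=> ee [f _ fK]; have fb := fK b; set u := f b in fb.
pose A' := zpow b (- k)%R * A * zpow b k.
have appA' : app A' (zpow a e) u = b.
  have := app_conj A' (zpow a e) (zpow b k) u; rewrite -zpowN /A'.
  have -> : zpow b k * (zpow b (- k) * A * zpow b k) * zpow b (- k) = A.
    by rewrite -!mulgA zpowKN -zpowD subrr mulg1.
  rewrite fb => /(congr1 (fun g => zpow b (- k)%R * g * zpow b k)).
  rewrite -!mulgA zpowNK -zpowD addNr mulg1 => <-.
  have -> : b * zpow b k = zpow b k * b by rewrite -zpowS addrC zpowD zpow1.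
  by rewrite zpowNK.
have : app a A' (app b (zpow a e) u) = zpow b 1 by rewrite app_app app_zpow app_b app_a appA'.
case/app_eq_power_b=> // p [m [r [_ eA']]]; exists p, m, r; rewrite -eA' /A'.
by rewrite -!mulgA zpowKN.
Qed.

(** With e = [ex gb A], the functional (e, -1) vanishes on the fixed line. For e = -1 the outer
    power in [A_shape] is an inverse and reverses the order of the factors, which replaces [i] by
    [2 - i]. *)
Lemma parabolic_AC (A B C D : fgroup 2) : local_rep A B C D ->
  ex ga A = 2%R -> ex gb B = 0%R -> ex ga C = 2%R -> (ex gb C * ex gb C = 1)%R ->
  (ex gb A * ex ga B = -1)%R ->
  exists i, A = parab1 i (ex gb A) /\
    C = parab1 (if ex gb A == 1 then i else 2 - i)%R (ex gb C).
Proof.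
move=> rep A2 B0 C2 CC AB; have [|eAB A1] := @mulz_eq1 (- ex ga B)%R (ex gb A).
  by rewrite mulNr mulrC AB.
have AA : (ex gb A * ex gb A = 1)%R by case: A1 => ->.
have NN : ((-1) * (-1) = 1 :> int)%R by [].
have nzA : (ex gb A != 0)%R by case: A1 => ->.
have nzC : (ex gb C != 0)%R by apply/eqP => e; move: CC; rewrite e.
have fixA : app (zpow a (ex gb A)) (app (zpow a (-1)) b C) A = zpow b (ex gb A * ex gb C)%R.
  by apply: (fixed_eq rep) => x y; rewrite A2 B0 => e1 e2; rewrite -e2; ring.
have [p [r [pr eC]]] := C_shape NN (mulf_neq0 nzA nzC) fixA.
have eA := A_shape AA nzC eC fixA; rewrite C2 in pr.
have er : r = (2 - p)%R by lia.
rewrite er in eA eC.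
case: A1 => A1; rewrite A1 in eA *.
  exists p; split; last exact: eC.
  by apply: etrans eA _; rewrite zpow1 /parab1; congr (zpow _ _ * _ * zpow _ _); ring.
exists (2 - p)%R; split; last by rewrite /= subKr; exact: eC.
apply: etrans eA _; rewrite zpowN1 !invgM -!zpowN /parab1 mulgA.
by congr (zpow _ _ * _ * zpow _ _); ring.
Qed.

(** The swapped quadruple has zero as its upper left entry; there ([ex ga D], 1) vanishes on the
    fixed line, and the shape becomes a conjugate by a power of [b]. *)
Lemma parabolic_BD (A B C D : fgroup 2) : local_rep A B C D ->
  ex gb B = 0%R -> ex ga C = 2%R -> ex gb D = 0%R ->
  (ex gb A * ex ga B = -1)%R -> (ex gb C * ex ga D = -1)%R ->
  exists k, B = parab2 k (ex gb A) /\ D = parab2 (ex gb C * k)%R (ex gb C).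
Proof.
move=> rep B0 C2 D0 AB CD; have rep' := local_rep_sw rep.
have [|eAB B1] := @mulz_eq1 (- ex gb A)%R (ex ga B); first by rewrite mulNr AB.
have [|eCD D1] := @mulz_eq1 (- ex gb C)%R (ex ga D); first by rewrite mulNr CD.
have DD : (ex ga D * ex ga D = 1)%R by case: D1 => ->.
have nzB : (ex ga B != 0)%R by case: B1 => ->.
have nzD : (ex ga D != 0)%R by case: D1 => ->.
have NN : (1 * 1 = 1 :> int)%R by [].
have fixD : app (zpow a (ex ga D)) (app (zpow a 1) b (sw B)) (sw D) = zpow b (ex ga D * ex ga B)%R.
  have := fixed_eq (m1 := ex ga D) (m2 := 1%R) rep'; rewrite !ex_sw; apply=> x y.
  rewrite D0 C2 -eCD => e1 e2; move: e2 D1; rewrite -eCD => e2 [D1|D1]; rewrite D1 in e2 *; lia.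
have := C_shape NN _ fixD; rewrite !ex_sw => /(_ (mulf_neq0 nzD nzB))[p [r [pr eB]]].
have := @A_shape (sw D) (sw B) (ex ga D) 1%R p r DD; rewrite !ex_sw => /(_ nzB eB fixD) eD.
have er : r = (- p)%R by lia.
rewrite er in eD eB; exists p; split.
  rewrite -[LHS]swK eB /parab2 !swM !sw_zpow sw_a sw_b; congr (_ * zpow _ _ * _); lia.
rewrite -[LHS]swK eD sw_zpow !swM !sw_zpow sw_a sw_b /parab2.
have -> : (- (ex ga D * 1 * p) = ex gb C * p)%R by rewrite -eCD; ring.
have -> : (- (ex ga D * 1 * - p) = - (ex gb C * p))%R by rewrite -eCD; ring.
by rewrite zpow_conj; congr (_ * zpow _ _ * _); lia.
Qed.

Lemma case_parabolic (A B C D : fgroup 2) : local_rep A B C D ->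
  ex ga A = 2%R -> ex gb B = 0%R -> ex ga C = 2%R -> ex gb D = 0%R ->
  (ex gb A * ex ga B = -1)%R -> (ex gb C * ex ga D = -1)%R -> reachable A B C D.
Proof.
move=> rep A2 B0 C2 D0 AB CD.
have [|eAB A1] := @mulz_eq1 (- ex ga B)%R (ex gb A); first by rewrite mulNr mulrC AB.
have [|eCD C1] := @mulz_eq1 (- ex ga D)%R (ex gb C); first by rewrite mulNr mulrC CD.
have AA : (ex gb A * ex gb A = 1)%R by case: A1 => ->.
have CC : (ex gb C * ex gb C = 1)%R by case: C1 => ->.
have [i [eA eC]] := parabolic_AC rep A2 B0 C2 CC AB.
have [k [eB eD]] := parabolic_BD rep B0 C2 D0 AB CD.
set e := ex gb A in AA A1 eAB eA eB eC *; set e' := ex gb C in CC C1 eCD eC eD *.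
have cA : c12 A = (i * e)%R.
  by rewrite eA !mag2M !mag_a // !mag_b // !exM !ex_zpow !ex_gen /=; ring.
have cB : c12 B = (k * e)%R.
  by rewrite eB !mag2M !mag_a // !mag_b // !exM !ex_zpow !ex_gen /=; ring.
have outer (z : fgroup 2) : (zpow A i * zpow B (e * i)) * zpow z (e * e') *
    (zpow B (e * (2 - i)) * zpow A (2 - i)) =
    (zpow a i * zpow b (e * i)) * zpow z (e * e') * (zpow b (e * (2 - i)) * zpow a (2 - i)).
  have [_ _ braid] := rep; have [E1 _ _] := braid _ a b z; move: E1.
  have appA (x y : fgroup 2) : app x y A = zpow x i * zpow y e * zpow x (2 - i)%R.
    by rewrite eA !appM !app_zpow app_a app_b.
  have appC (x y : fgroup 2) : zpow (app x y C) e = zpow x (e * i) * zpow y (e * e') * zpow x (e * (2 - i))%R.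
    rewrite eC !appM !app_zpow app_a app_b.
    case: A1 => ->; first by rewrite eqxx zpow1 !mul1r.
    by rewrite (_ : (-1 == 1 :> int)%R = false) // zpowN1 !invgM -!zpowN !mulN1r subKr mulgA.
  by rewrite !app_ab [app _ _ A]appA [app a _ A]appA !appC !mulgA.
have nz : (e * e' != 0)%R by case: A1 => ->; case: C1 => ->.
have [c12P c12Q] := outer_c12 nz outer.
(* The left outer factors of [z] give [r1], the right ones [r2]; the family k = e (1 - i) satisfies
   both. *)
have r1 : (i = 0 \/ k = e * (1 - i))%R.
  move: c12P (c12_zpow A i) (c12_zpow B (e * i)).
  rewrite !mag2M !ex_zpow !ex_gen A2 B0 cA cB mag_a // mag_b //= -/e => c1 c2 c3.
  have /eqP : (i * (k - e * (1 - i)) = 0)%R by case: A1 c1 c2 c3 => ->; lia.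
  by rewrite mulf_eq0 subr_eq0 => /orP[/eqP->|/eqP->]; [left | right].
have r2 : (i = 2 \/ k = e * (1 - i))%R.
  move: c12Q (c12_zpow A (2 - i)) (c12_zpow B (e * (2 - i))).
  have eB' : ex ga B = (- e)%R by lia.
  rewrite !mag2M !ex_zpow !ex_gen A2 B0 cA cB eB' mag_a // mag_b //= -/e => c1 c2 c3.
  have /eqP : ((2 - i) * (k - e * (1 - i)) = 0)%R by case: A1 c1 c2 c3 => ->; lia.
  by rewrite mulf_eq0 !subr_eq0 => /orP[/eqP->|/eqP->]; [left | right].
(* Being a basis makes A b^k equal to some b^k a^p b^m a^r. The coefficient of abab is i e (2 - i) k
   on the left, and on the right it is 0. *)
have r3 : (i * e * (2 - i) * k = 0)%R.
  have [bijAB _ _] := rep; rewrite eB in bijAB.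
  have NN : ((- e) * (- e) = 1)%R by rewrite mulrNN.
  have [p [m [r eq_conj]]] := basis_conj NN bijAB; rewrite eA /parab1 in eq_conj.
  move: (congr1 (fun g : fgroup 2 => mag g [:: ga; gb; ga; gb]) eq_conj).
  do 4!rewrite ?(magM, mag_reduce, mag_cat) /=.
  rewrite !(mag_a, mag_b) //=.
  lia.
have RD := reachable_D AA CC.
(* i = 1 is type C, i = 2 is type D, and i = 0 is type D read backwards. *)
have [[ei ek]|[ei ek]|[ei ek]] : [\/ i = 1%R /\ k = 0%R, i = 2%R /\ k = (- e)%R | i = 0%R /\ k = e].
  have e0 : e != 0%R by case: A1 => ->.
  move/eqP: r3; rewrite !mulf_eq0 (negPf e0) orbF subr_eq0 => /orP[/orP[/eqP h|/eqP h]|/eqP h].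
  - by constructor 3; split=> //; case: r2; lia.
  - by constructor 2; split=> //; case: r1; lia.
  by constructor 1; split=> //; case: A1 r1 r2 => ->; lia.
- rewrite eA eB eC eD ei ek mulr0.
  have -> : (if e == 1 then 1 else 2 - 1)%R = (1 : int)%R by case: (e == 1%R).
  exact: reachable_C.
- rewrite eA eB eC eD ei ek subrr mulrN [(e' * e)%R]mulrC; exact: RD.
have := reachable_rv RD; rewrite !rv_parab1 !rv_parab2 !opprK subrr.
rewrite eA eB eC eD ei ek [(e' * e)%R]mulrC subr0.
by case: ifP => _; rewrite ?subrr ?subr0.
Qed.

(** * Diagonal matrices *)

Lemma identity_AB (A B C D : fgroup 2) (d : int) : local_rep A B C D -> (d * d = 1)%R ->
  ex ga A = 1%R -> ex gb A = 0%R -> ex ga B = 0%R -> ex gb B = d -> ex ga C = d -> ex ga D = 0%R ->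
  A = a /\ B = zpow b d.
Proof.
move=> [_ _ braid] dd A1 A0 B0 Bd Cd D0; have [E1 E2 _] := braid _ a b (1 : fgroup 2).
move: E1 E2; rewrite !app_ab !app_pow_r Cd D0 zpow0 app_pow_r Cd => E1 E2.
(* The equations at [z = 1]: the braid relation between [tau] and the involution [eps]. *)
pose eps (g : fgroup 2) : fgroup 2 := app a (zpow b d) g.
pose tau (g : fgroup 2) : fgroup 2 := app A B g.
pose sig (g : fgroup 2) : fgroup 2 := app A (zpow B d) g.
have sigE g : sig g = tau (eps g) by rewrite /tau /eps app_app app_zpow app_a app_b.
have epsK g : eps (eps g) = g by rewrite /eps app_app app_zpow app_a app_b zpow_sgn1 // app_ab.
have braidE g : sig (tau g) = eps (tau (eps g)).
  rewrite -sigE /sig /eps /tau !app_app E1 E2; congr app.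
  by rewrite app_zpow.
(* From tau eps tau = eps tau eps: sig^2 = eps tau, and sig^4 = eps (tau eps tau) = tau eps =
   sig. *)
have sig2 g : sig (sig g) = eps (tau g) by rewrite [sig g]sigE braidE epsK.
have sig4 g : sig (sig (sig (sig g))) = sig g.
  by rewrite sig2 sig2 -[tau (eps _)]sigE braidE epsK sigE.
have sig_id : forall g, sig g = g.
  apply: IA_torsion_trivial => // [g h|i g]; first exact: appM.
  rewrite /sig ex_app ex_zpow; case: (ord2P i) => ->; rewrite ?A1 ?A0 ?B0 ?Bd ?dd; ring.
split; first by rewrite -[RHS]sig_id /sig app_a.
by rewrite -[LHS](zpow_sgn1 _ dd) -[b in RHS]sig_id /sig app_b.
Qed.

Lemma case_identity (A B C D : fgroup 2) : local_rep A B C D ->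
  ex gb A = 0%R -> ex ga B = 0%R -> ex gb C = 0%R -> ex ga D = 0%R ->
  ex ga A = 1%R -> ex gb D = 1%R -> ex ga C = ex gb B -> (ex gb B * ex gb B = 1)%R ->
  reachable A B C D.
Proof.
move=> rep A0 B0 C0 D0 A1 D1 CB dd.
have [-> ->] := identity_AB rep dd A1 A0 B0 erefl CB D0.
have := identity_AB (d := ex gb B) (local_rep_sw rep); rewrite !ex_sw.
move=> /(_ dd D1 D0 C0 CB erefl A0)[/(congr1 sw) eD /(congr1 sw) eC].
rewrite !swK !sw_zpow ?sw_a ?sw_b in eD eC; rewrite eD eC; exact: reachable_T.
Qed.

(** * Exclusion of the trace-zero class *)

Lemma zpow2 (G : groupType) (x : G) : zpow x 2%R = x * x.
Proof. by rewrite -[X in X * _]zpow1 -zpowS. Qed.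

Lemma zpow3 (G : groupType) (x : G) : zpow x 3%R = x * x * x.
Proof. by rewrite -zpow2 -zpowS. Qed.

(** In A4 the elements t, u t and u t^2 lie outside the Klein four-group and have order 3, so
    exponents divisible by 3 disappear on them, while only parity matters for u. *)
Lemma alternating_group_4 : exists (G : groupType) (t u : G),
  [/\ zpow t 3%R = 1, zpow u 2%R = 1, zpow (u * t) 3%R = 1, zpow (u * zpow t 2%R) 3%R = 1 &
    u <> 1].
Proof.
have inj_t : injective (fun z : bool * bool => (z.2, z.1 (+) z.2)) by move=> [[] []] [[] []].
have inj_u : injective (fun z : bool * bool => (~~ z.1, z.2)) by move=> [[] []] [[] []].
(* Affine maps of the plane over the field with two elements: a linear map of order 3, a translation. *)
exists {perm bool * bool}, (perm inj_t), (perm inj_u); split.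
- by apply/permP => z; rewrite ?(zpow2, zpow3) !permM !permE /=; case: z => [] [] [].
- by apply/permP => z; rewrite ?(zpow2, zpow3) !permM !permE /=; case: z => [] [] [].
- by apply/permP => z; rewrite ?(zpow2, zpow3) !permM !permE /=; case: z => [] [] [].
- by apply/permP => z; rewrite ?(zpow2, zpow3) !permM !permE /=; case: z => [] [] [].
by move/permP/(_ (true, true)); rewrite !permE.
Qed.

Lemma zpow_mul_eq1 (G : groupType) (x : G) m k : zpow x m = 1 -> zpow x (m * k)%R = 1.
Proof. by move=> xm; rewrite zpowM xm zpow1g. Qed.

Lemma divisors_of_3 (x y : int) : (x * y = -3)%R ->
  (x = 1 \/ x = -1)%R /\ (y = 3 \/ y = -3)%R \/ (x = 3 \/ x = -3)%R /\ (y = 1 \/ y = -1)%R.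
Proof.
move=> xy; have /(congr1 absz) := xy; rewrite abszM => axy.
have : `|x|%N \in divisors 3 by rewrite -dvdn_divisors // -[3]/`|(-3)%R|%N -axy dvdn_mulr.
rewrite (_ : divisors 3 = [:: 1; 3]%N) // !inE => /orP[] /eqP ax.
  have [ex|ex] : (x = 1 \/ x = -1)%R by lia.
    by left; subst x; lia.
  by left; subst x; lia.
have [ex|ex] : (x = 3 \/ x = -3)%R by lia.
  by right; subst x; lia.
by right; subst x; lia.
Qed.

(** With lower right entry 2, the second coordinate of the fixed-vector equation is itself the
    vanishing of ([ex gb A], 1). *)
Lemma fixed_eq_B2 (A B C D : fgroup 2) : local_rep A B C D ->
  ex gb B = 2%R -> app (zpow a (ex gb A)) (app (zpow a 1) b C) A = zpow b (ex gb A * ex gb C)%R.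
Proof. by move=> rep B2; apply: (fixed_eq rep) => x y; rewrite B2 => _; lia. Qed.

Lemma case_excluded (A B C D : fgroup 2) : local_rep A B C D ->
  ex ga A = (-2)%R -> ex gb B = 2%R -> ex ga C = 2%R -> ex gb D = (-2)%R ->
  (ex gb A * ex ga B = -3)%R -> (ex gb C * ex ga D = -3)%R -> False.
Proof.
move=> rep A2 B2 C2 D2 AB CD.
have NN : (1 * 1 = 1 :> int)%R by [].
have nz (x y : int) : (x * y = -3)%R -> x != 0%R /\ y != 0%R.
  by move=> xy; split; apply/eqP => e; move: xy; rewrite e; lia.
have [nzA nzB] := nz _ _ AB; have [nzC nzD] := nz _ _ CD.
have fixA := fixed_eq_B2 rep B2.
have fixD := fixed_eq_B2 (local_rep_sw rep); rewrite !ex_sw in fixD; have {}fixD := fixD C2.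
have [p [r [pr eC]]] := C_shape NN (mulf_neq0 nzA nzC) fixA.
have := C_shape NN (mulf_neq0 nzD nzB) fixD; rewrite !ex_sw => -[k [s [ks eB]]].
have {}eB : B = zpow b k * zpow a (ex ga B) * zpow b s.
  by rewrite -[LHS]swK eB !swM !sw_zpow sw_a sw_b.
have er : r = (2 - p)%R by lia.
have [G [t [u [t3 u2 ut3 utt3 nt_u]]]] := alternating_group_4.
have odd_u m : zpow u (2 * m + 1)%R = u by rewrite zpowD (zpow_mul_eq1 _ u2) mul1g zpow1.
have [[A1 B3]|[A3 B1]] := divisors_of_3 AB.
  (* Here B(t, u) = u^2 = 1, so the first braid equation at (t, u, 1) says that X = A(t, u)
     satisfies X^-2 = t^-2. As X is conjugate by a power of t to an element of order dividing 3, X =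
     t, and this forces u = 1. *)
  have tB : zpow t (ex ga B) = 1.
    by case: B3 => ->; rewrite ?(zpow_mul_eq1 1 t3) ?(zpow_mul_eq1 (-1) t3).
  have appB : app t u B = 1.
    by rewrite eB !appM !app_zpow app_a app_b tB mulg1 -zpowD ks B2.
  have [_ _ braid] := rep; have [E1 _ _] := braid _ t u (1 : G); move: E1.
  rewrite appB !app_pow_r C2 zpow1g u2 !app_pow_r A2 => eqX.
    have AA : (ex gb A * ex gb A = 1)%R by case: A1 => ->.
  have eA := A_shape AA nzC eC fixA; rewrite er in eA.
  set e := ex gb A in A1 AA eA *.
  have appA : app t u A = zpow t (- (e * p))%R * zpow (u * zpow t (- (2 * e))%R) e * zpow t (e * p)%R.
    rewrite eA app_zpow !appM !app_zpow app_a app_b -{2}[(e * p)%R]opprK -zpow_conj opprK mulr1.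
    by rewrite -!mulgA -zpowD; congr (zpow (_ * (_ * zpow _ _)) _); ring.
  set Z := zpow (u * _) e in appA.
  have tN2 : zpow t (- 2)%R = t.
    by rewrite -[RHS]zpow1 (_ : 1 = 3 + - 2)%R // zpowD t3 mul1g.
  have Z3 : zpow Z 3%R = 1.
    rewrite /Z -zpowM [(e * 3)%R]mulrC zpowM; case: A1 => ->.
      by rewrite mulr1 tN2 ut3 zpow1g.
    by rewrite mulrN1 opprK utt3 zpow1g.
  have X3 : zpow (app t u A) 3%R = 1.
    rewrite appA -{2}[(e * p)%R]opprK zpow_conj Z3 mulg1 opprK -zpowD addNr.
    by [].
  have Xt : app t u A = t.
    by rewrite -[LHS]zpow1 (_ : 1 = 3 + - 2)%R // zpowD X3 mul1g eqX tN2.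
  have Zt : Z = t.
    rewrite Xt in appA; apply: (mulgI (zpow t (- (e * p))%R)); apply: (mulIg (zpow t (e * p)%R)).
    by rewrite -appA -zpowS addrC zpowD zpow1 -mulgA -zpowD addNr mulg1.
  apply: nt_u; move: Zt; rewrite /Z; case: A1 => ->.
    by rewrite mulr1 tN2 zpow1 => /(congr1 (fun g => g * t^-1)); rewrite mulgK mulgV.
  rewrite mulrN1 opprK zpowN1 => /(congr1 (fun g => (zpow t 2%R * g)^-1)).
  by rewrite invgM invgK mulgK -zpowS (_ : 2 + 1 = 3)%R // t3 invg1.
(* Now [ex gb A] is 3 or -3. C(t, u) is a conjugate of u t^2, so the left side is 1, while the odd
   exponent on the right leaves u. *)
have fixG : zpow (app t u C) (ex gb A) = zpow u (ex gb A * ex gb C)%R.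
  have := congr1 (fun g : fgroup 2 => app t u g) fixA.
  rewrite !app_app !app_zpow app_a app_b zpow1 => <-.
  have -> : zpow t (ex gb A) = 1.
    by case: A3 => ->; rewrite ?(zpow_mul_eq1 1 t3) ?(zpow_mul_eq1 (-1) t3).
  by rewrite app_pow_l.
have odd3 (x y : int) : (x * y = -3)%R -> exists m, x = (2 * m + 1)%R.
  case/divisors_of_3 => -[[] -> _].
  - by exists 0%R.
  - by exists (-1)%R.
  - by exists 1%R.
  by exists (-2)%R.
have [m1 eA] := odd3 _ _ AB; have [m2 eC'] := odd3 _ _ CD.
have appC : app t u C = zpow t p * (u * zpow t 2%R) * zpow t (- p)%R.
  by rewrite eC !appM !app_zpow app_a app_b eC' odd_u er zpowD !mulgA.
apply: nt_u; move: fixG; rewrite appC zpow_conj.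
have -> : zpow (u * zpow t 2%R) (ex gb A) = 1.
  by case: A3 => ->; rewrite ?(zpow_mul_eq1 1 utt3) ?(zpow_mul_eq1 (-1) utt3).
rewrite mulg1 -zpowD subrr zpow0 eA eC'.
have -> : ((2 * m1 + 1) * (2 * m2 + 1) = 2 * (2 * m1 * m2 + m1 + m2) + 1)%R by ring.
by rewrite odd_u.
Qed.

(** * The classification from the homology classes *)

Lemma local_rep_reachable (A B C D : fgroup 2) : local_rep A B C D -> reachable A B C D.
Proof.
move=> rep; have [bijAB bijCD _] := rep.
have [[h1 h2 h3 h4] [h5 h6 h7]] := abelian_eqs rep.
case: (abelian_classes h1 h2 h3 h4 h5 h6 h7 (abelian_det bijAB) (abelian_det bijCD)).
- by case=> -[A0 B0 C0 D0] A1 D1 CB dd; apply: case_identity.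
- case=> -[A0 B0 C0 D0] eqd dd.
  have [|_ [d1|d1]] := @mulz_eq1 (ex gb A * ex ga B)%R (ex gb A * ex ga B)%R; first by [].
    by apply: case_reflection => //; rewrite -eqd.
  by apply: case_rotation => //; rewrite -eqd.
- by case=> A2 B0 C2 D0 [AB CD]; apply: case_parabolic.
(* The swap interchanges the diagonal entries 0 and 2 and leads back to the parabolic class. *)
case=> -[A0 B2 C0 D2 [AB CD]]; last by case: (case_excluded rep).
apply: reachable_swE; apply: case_parabolic; rewrite ?ex_sw //; first exact: local_rep_sw.
  by rewrite mulrC.
by rewrite mulrC.
Qed.

Theorem theorem2p1 (A B C D : word 2) :
  reduced A -> reduced B -> reduced C -> reduced D ->
  (local_braid_rep (A, B, C, D) <->
   exists L : quad, listed L /\ up_to_sym L (A, B, C, D)).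
Proof.
move=> rA rB rC rD; rewrite (quad_of_surj rA rB rC rD).
split=> [/local_repP/local_rep_reachable//|[L [listedL symL]]].
have [A' [B' [C' [D' [-> rep]]]]] := local_rep_up_to_sym symL (listed_local_rep listedL).
exact/local_repP.
Qed.
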